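(* Let $\mathbb U$ be an ensemble of $n$-qubit unitary channels whose ideal randomized-measurement map $\mathcal M=\mathbb E_{\mathcal U\in\mathbb U}[\mathcal U^\dagger\mathcal M_{\mathbb Z}\,\mathcal U]$ is invertible. For each $\mathcal U\in\mathbb U$ let the noisy implementation be $\tilde{\mathcal U}=\mathcal E_{\mathcal U}\,\mathcal U$ with $\mathcal E_{\mathcal U}$ a quantum channel that may depend on $\mathcal U$, suppose there is an invertible linear map $\mathcal E'_{\mathcal U}$ with $\mathcal E'_{\mathcal U}\mathcal M_{\mathbb Z}=\mathcal M_{\mathbb Z}\mathcal E_{\mathcal U}$, and let $\mathcal E'^{-1}_{\mathcal U}=\sum_{\mathcal B\in\mathbb B}Q'_{\mathcal U,\mathcal B}\,\mathcal B$ with real coefficients and $\gamma'_{\mathcal U}=\sum_{\mathcal B\in\mathbb B}|Q'_{\mathcal U,\mathcal B}|$. Let $\rho$ be an $n$-qubit state, $O$ a Hermitian observable and $o=\operatorname{Tr}(O\rho)$. Draw $\mathcal U$ from $\mathbb U$; given $\mathcal U$, let $b$ be the outcome of measuring $\tilde{\mathcal U}(\rho)$ in the computational basis, $\Pr(b|\mathcal U)=\langle\langle b|\tilde{\mathcal U}|\rho\rangle\rangle$, and, independently, draw $\mathcal B\in\mathbb B$ with probability $\Pr(\mathcal B|\mathcal U)=|Q'_{\mathcal U,\mathcal B}|/\gamma'_{\mathcal U}$. Then $$\hat o=\gamma'_{\mathcal U}\,\frac{Q'_{\mathcal U,\mathcal B}}{|Q'_{\mathcal U,\mathcal B}|}\,\langle\langle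 O|\mathcal M^{-1}\mathcal U^\dagger\mathcal B|b\rangle\rangle$$ is an unbiased estimator of $o$. Moreover, suppose $M$ random circuits are sampled independently, each is measured for $K$ shots, and for each shot $L$ random instances of $\mathcal B$ are generated, and let $\hat o_{\mathrm{tot}}$ be the mean of the resulting $M\times K\times L$ estimators. Then $$\operatorname{Var}[\hat o_{\mathrm{tot}}]\le\frac1M\left\{\frac{\gamma'^2_{\max}}{K}\left[\frac1L\|O\|_{\mathrm{NS1}}^2+\Big(1-\frac1L\Big)\|O\|_{\mathrm{NS2}}^2\right]+\Big(1-\frac1K\Big)\|O\|_{\mathrm{XS}}^2\right\},$$ where $\gamma'_{\max}=\max_{\mathcal U}\gamma'_{\mathcal U}$, the noisy shadow norms $\|O\|_{\mathrm{NS1}},\|O\|_{\mathrm{NS2}}$ and the noiseless cross-shadow norm $\|O\|_{\mathrm{XS}}$ are as defined in the context, and $\|O\|_{\mathrm{NS2}}\le\|O\|_{\mathrm{NS1}}$.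
   Context: Notation: $\langle\langle A|B\rangle\rangle=\operatorname{Tr}(A^\dagger B)$, $\langle\langle A|\mathcal E|B\rangle\rangle=\operatorname{Tr}(A^\dagger\mathcal E(B))$, juxtaposition of maps is composition, $|b\rangle\rangle$ is the vectorization of $|b\rangle\langle b|$ for $b\in\{0,1\}^n$, and $\mathcal M_{\mathbb Z}=\sum_b|b\rangle\rangle\langle\langle b|$ is the computational-basis measurement channel. For a unitary channel $\mathcal U(\rho)=U\rho U^\dagger$, $\mathcal U^\dagger(\rho)=U^\dagger\rho U$. $\mathbb B$ is a finite set of basis operations (completely positive, trace-non-increasing maps, e.g. Clifford channels and projections onto Pauli eigenstates). In the $M\times K\times L$ scheme, given the circuit $\mathcal U_m$, the shots $b_{m,k}$ are i.i.d. and the instances $\mathcal B_{m,k,l}$ are i.i.d. with the stated conditional distributions, all conditionally independent. Write $\operatorname{sgn}(\mathcal B)=Q'_{\mathcal U,\mathcal B}/|Q'_{\mathcal U,\mathcal B}|$. With maxima over density operators $\rho$, $$\|O\|_{\mathrm{NS1}}=\max_\rho\Big(\mathbb E_{\mathcal U}\sum_b\langle\langle b|\tilde{\mathcal U}|\rho\rangle\rangle\sum_{\mathcal B}\Pr(\mathcal B|\mathcal U)\,\langle\langle O|\mathcal M^{-1}\mathcal U^\dagger\mathcal B|b\rangle\rangle^2\Big)^{1/2},$$ $$\|O\|_{\mathrm{NS2}}=\max_\rho\Big(\mathbb E_{\mathcal U}\sum_b\langle\langle b|\tilde{\mathcal U}|\rho\rangle\rangle\Big(\sum_{\mathcal B}\Pr(\mathcal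 B|\mathcal U)\operatorname{sgn}(\mathcal B)\,\langle\langle O|\mathcal M^{-1}\mathcal U^\dagger\mathcal B|b\rangle\rangle\Big)^2\Big)^{1/2},$$ $$\|O\|_{\mathrm{XS}}=\max_\rho\Big(\mathbb E_{\mathcal U}\sum_{b,b'}\langle\langle O|\mathcal M^{-1}\mathcal U^\dagger|b\rangle\rangle\langle\langle O|\mathcal M^{-1}\mathcal U^\dagger|b'\rangle\rangle\langle\langle b|\mathcal U|\rho\rangle\rangle\langle\langle b'|\mathcal U|\rho\rangle\rangle\Big)^{1/2}.$$ *)

(* Defs.v *)
From HB Require Import structures.
From mathcomp Require Import all_boot all_order all_algebra sesquilinear spectral.
From mathcomp Require Import all_classical all_reals all_analysis.
From mathcomp Require Import complex.

Set Implicit Arguments.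
Unset Strict Implicit.
Unset Printing Implicit Defensive.
Import Order.TTheory GRing.Theory Num.Theory.
Import numFieldNormedType.Exports.
Local Open Scope classical_set_scope.
Local Open Scope sesquilinear_scope.
Local Open Scope complex_scope.
Local Open Scope ring_scope.

(* An n-qubit operator is a matrix of size N = 2 ^ n, and the index b : 'I_N
   is the integer whose binary expansion is the bit string b in {0,1}^n. *)

(* <<A|B>> = Tr(A^dagger B) *)
Definition hsdot (R : realType) (N : nat) (A B : 'M[R[i]]_N) : R[i] :=
  \tr (A^t* *m B).

(* |b><b|, whose vectorization is |b>> *)
Definition ketbra (R : realType) (N : nat) (b : 'I_N) : 'M[R[i]]_N :=
  delta_mx b b.

(* 0 <= z in R[i] means that z is real and nonnegative. *)
Definition psd (R : realType) (N : nat) (A : 'M[R[i]]_N) : Prop :=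
  forall v : 'cV[R[i]]_N, 0 <= (v^t* *m A *m v) 0 0.

Definition density (R : realType) (N : nat) : set 'M[R[i]]_N :=
  [set rho | psd rho /\ \tr rho = 1].

(* id_k (x) Phi, acting on k x k block matrices with N x N blocks *)
Definition ampliation (R : realType) (N k : nat)
    (Phi : 'M[R[i]]_N -> 'M[R[i]]_N) (X : 'M[R[i]]_(\sum_(i < k) N)) :
    'M[R[i]]_(\sum_(i < k) N) :=
  \mxblock_(i < k, j < k) Phi (submxblock X i j).

Definition completely_positive (R : realType) (N : nat)
    (Phi : 'M[R[i]]_N -> 'M[R[i]]_N) : Prop :=
  forall (k : nat) (X : 'M[R[i]]_(\sum_(i < k) N)),
    psd X -> psd (ampliation Phi X).

Definition trace_nonincreasing (R : realType) (N : nat)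
    (Phi : 'M[R[i]]_N -> 'M[R[i]]_N) : Prop :=
  forall X, psd X -> \tr (Phi X) <= \tr X.

Definition quantum_channel (R : realType) (N : nat)
    (Phi : 'M[R[i]]_N -> 'M[R[i]]_N) : Prop :=
  completely_positive Phi /\ (forall X, \tr (Phi X) = \tr X).

Definition uchan (R : realType) (N : nat) (U : 'M[R[i]]_N) (X : 'M[R[i]]_N) :
  'M[R[i]]_N := U *m X *m U^t*.

Definition uchan_dag (R : realType) (N : nat) (U : 'M[R[i]]_N)
    (X : 'M[R[i]]_N) : 'M[R[i]]_N := U^t* *m X *m U.

(* M_Z = \sum_b |b>> <<b| *)
Definition meas_channel (R : realType) (N : nat) (X : 'M[R[i]]_N) :
    'M[R[i]]_N :=
  \sum_(b < N) hsdot (ketbra R b) X *: ketbra R b.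

(* Measurability in t of a family of superoperators, coordinate by coordinate *)
Definition measurable_superop (R : realType) (N : nat) (d : measure_display)
    (T : measurableType d) (F : T -> 'M[R[i]]_N -> 'M[R[i]]_N) : Prop :=
  forall X i j, measurable_fun setT (fun t => complex.Re (F t X i j)) /\
                measurable_fun setT (fun t => complex.Im (F t X i j)).

(* Entrywise expectation of a random complex matrix *)
Definition expect_mx (R : realType) (N : nat) (d : measure_display)
    (T : measurableType d) (mu : probability T R) (F : T -> 'M[R[i]]_N) :
    'M[R[i]]_N :=
  \matrix_(i, j) ((\int[mu]_t complex.Re (F t i j)) +i*
                  (\int[mu]_t complex.Im (F t i j))).

(* An ensemble of unitary channels is a probability space (T, mu) together with
   a unitary matrix U t for each t : T; the random circuit is the channel
   [uchan (U t)] with t distributed according to mu. *)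
Definition shadow_map (R : realType) (N : nat) (d : measure_display)
    (T : measurableType d) (mu : probability T R) (U : T -> 'M[R[i]]_N)
    (X : 'M[R[i]]_N) : 'M[R[i]]_N :=
  expect_mx mu (fun t => uchan_dag (U t) (meas_channel (uchan (U t) X))).

(* Pr(b|U) = <<b| E_U U |rho>>; the bracket is real for a state rho. *)
Definition shot_prob (R : realType) (N : nat) (T : Type) (U : T -> 'M[R[i]]_N)
    (E : T -> 'M[R[i]]_N -> 'M[R[i]]_N) (rho : 'M[R[i]]_N) (t : T)
    (b : 'I_N) : R :=
  complex.Re (hsdot (ketbra R b) (E t (uchan (U t) rho))).

Definition gamma' (R : realType) (T : Type) (I : finType) (Q : T -> I -> R)
    (t : T) : R := \sum_(B : I) `|Q t B|.

(* The supremum over the circuits of the ensemble, which is the maximum when it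
   is attained, for instance for a finite ensemble. *)
Definition gamma'_max (R : realType) (T : Type) (I : finType)
    (Q : T -> I -> R) : R := sup (range (gamma' Q)).

(* Pr(B|U) *)
Definition inst_prob (R : realType) (T : Type) (I : finType) (Q : T -> I -> R)
    (t : T) (B : I) : R := `|Q t B| / gamma' Q t.

Definition inst_sgn (R : realType) (T : Type) (I : finType) (Q : T -> I -> R)
    (t : T) (B : I) : R := Q t B / `|Q t B|.

(* <<O| M^-1 U^dagger Phi |b>>.  It is real whenever O is Hermitian and Phi
   (like M) preserves Hermiticity, which covers every use below. *)
Definition shadow_bracket (R : realType) (N : nat) (T : Type)
    (U : T -> 'M[R[i]]_N) (Minv : 'M[R[i]]_N -> 'M[R[i]]_N) (O : 'M[R[i]]_N)
    (Phi : 'M[R[i]]_N -> 'M[R[i]]_N) (t : T) (b : 'I_N) : R :=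
  complex.Re (hsdot O (Minv (uchan_dag (U t) (Phi (ketbra R b))))).

Definition estimator (R : realType) (N : nat) (T : Type) (I : finType)
    (U : T -> 'M[R[i]]_N) (Minv : 'M[R[i]]_N -> 'M[R[i]]_N)
    (op : I -> 'M[R[i]]_N -> 'M[R[i]]_N) (Q : T -> I -> R) (O : 'M[R[i]]_N)
    (t : T) (b : 'I_N) (B : I) : R :=
  gamma' Q t * inst_sgn Q t B * shadow_bracket U Minv O (op B) t b.

(* The maxima over states are written as suprema: the density operators form a
   compact set, on which the maximized functions are continuous. *)
Definition norm_NS1 (R : realType) (N : nat) (d : measure_display)
    (T : measurableType d) (I : finType) (mu : probability T R)
    (U : T -> 'M[R[i]]_N) (E : T -> 'M[R[i]]_N -> 'M[R[i]]_N)
    (Minv : 'M[R[i]]_N -> 'M[R[i]]_N) (op : I -> 'M[R[i]]_N -> 'M[R[i]]_N)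
    (Q : T -> I -> R) (O : 'M[R[i]]_N) : R :=
  sup [set Num.sqrt (\int[mu]_t (\sum_(b < N) shot_prob U E rho t b *
         (\sum_(B : I) inst_prob Q t B *
            shadow_bracket U Minv O (op B) t b ^+ 2)))
      | rho in @density R N].

Definition norm_NS2 (R : realType) (N : nat) (d : measure_display)
    (T : measurableType d) (I : finType) (mu : probability T R)
    (U : T -> 'M[R[i]]_N) (E : T -> 'M[R[i]]_N -> 'M[R[i]]_N)
    (Minv : 'M[R[i]]_N -> 'M[R[i]]_N) (op : I -> 'M[R[i]]_N -> 'M[R[i]]_N)
    (Q : T -> I -> R) (O : 'M[R[i]]_N) : R :=
  sup [set Num.sqrt (\int[mu]_t (\sum_(b < N) shot_prob U E rho t b *
         (\sum_(B : I) inst_prob Q t B * inst_sgn Q t B *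
            shadow_bracket U Minv O (op B) t b) ^+ 2))
      | rho in @density R N].

(* Noiseless: the shot probabilities are those of E_U = id. *)
Definition norm_XS (R : realType) (N : nat) (d : measure_display)
    (T : measurableType d) (mu : probability T R) (U : T -> 'M[R[i]]_N)
    (Minv : 'M[R[i]]_N -> 'M[R[i]]_N) (O : 'M[R[i]]_N) : R :=
  sup [set Num.sqrt (\int[mu]_t (\sum_(b < N) \sum_(b' < N)
         shadow_bracket U Minv O id t b * shadow_bracket U Minv O id t b' *
         shot_prob U (fun=> id) rho t b * shot_prob U (fun=> id) rho t b'))
      | rho in @density R N].

(* (Uw, bw, Bw) is a single draw (circuit, outcome, basis operation): the
   circuit has law mu and, given the circuit, bw and Bw are independent with
   conditional laws p and q. *)
Definition single_draw (R : realType) (N : nat) (d d' : measure_display)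
    (T : measurableType d) (W : measurableType d') (I : finType)
    (mu : probability T R) (p : T -> 'I_N -> R) (q : T -> I -> R)
    (P : probability W R) (Uw : W -> T) (bw : W -> 'I_N) (Bw : W -> I) : Prop :=
  [/\ measurable_fun setT Uw,
      forall x, measurable (bw @^-1` [set x]),
      forall y, measurable (Bw @^-1` [set y]) &
      forall (A : set T) (x : 'I_N) (y : I), measurable A ->
        P [set w | [/\ A (Uw w), bw w = x & Bw w = y]] =
        (\int[mu]_(t in A) (p t x * q t y)%:E)%E].

(* M x K x L scheme: the M circuits are i.i.d. of law mu, the different circuits
   carry independent data, and given the circuit of index m the outcomes
   bw m k are i.i.d. of law p, the instances Bw m k l are i.i.d. of law q, all of
   them conditionally independent.  This is the product form of the joint law. *)
Definition mkl_scheme (R : realType) (N M K L : nat) (d d' : measure_display)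
    (T : measurableType d) (W : measurableType d') (I : finType)
    (mu : probability T R) (p : T -> 'I_N -> R) (q : T -> I -> R)
    (P : probability W R) (Uw : 'I_M -> W -> T)
    (bw : 'I_M -> 'I_K -> W -> 'I_N)
    (Bw : 'I_M -> 'I_K -> 'I_L -> W -> I) : Prop :=
  [/\ forall m, measurable_fun setT (Uw m),
      forall m k x, measurable (bw m k @^-1` [set x]),
      forall m k l y, measurable (Bw m k l @^-1` [set y]) &
      forall (A : 'I_M -> set T) (x : 'I_M -> 'I_K -> 'I_N)
             (y : 'I_M -> 'I_K -> 'I_L -> I),
        (forall m, measurable (A m)) ->
        P [set w | forall m, A m (Uw m w) /\
             forall k, bw m k w = x m k /\
               forall l, Bw m k l w = y m k l] =
        (\prod_(m < M) \int[mu]_(t in A m)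
           (\prod_(k < K) (p t (x m k) *
              \prod_(l < L) q t (y m k l)))%R%:E)%E].

(* Main.v *)
Require Import Defs.
From HB Require Import structures.
From mathcomp Require Import all_boot all_order all_algebra sesquilinear spectral.
From mathcomp Require Import all_classical all_reals all_analysis.
From mathcomp Require Import measurable_realfun complex.
From mathcomp Require Import ring lra.

Set Implicit Arguments.
Unset Strict Implicit.
Unset Printing Implicit Defensive.
Import Order.TTheory GRing.Theory Num.Theory.
Import numFieldNormedType.Exports.
Local Open Scope classical_set_scope.
Local Open Scope sesquilinear_scope.
Local Open Scope complex_scope.
Local Open Scope ring_scope.

(* Given the circuit, summing the estimator over B against Pr(B|U) turns
   gamma' sgn(B) Pr(B|U) into Q', hence replaces B by E'^-1; summing over b
   against the noisy outcome law then gives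
   <<O| M^-1 U^dagger E'^-1 M_Z E U |rho>> = <<O| M^-1 U^dagger M_Z U |rho>>,
   because M_Z E = E' M_Z.  So the conditional mean given the circuit is the
   noiseless signal, whose mean over the circuits is Tr(O rho).

   The circuits carry independent data, so the variance of the total mean is
   at most 1/M times the second moment of the mean of one round.  Expanding that
   square over pairs of (shot, instance), a fraction 1/(KL) of the pairs is
   diagonal (NS1), a fraction (1/K)(1 - 1/L) shares the shot only (NS2), and for
   the remaining 1 - 1/K the two shots are conditionally independent, so that
   they contribute the square of the noiseless signal (XS). *)

(** * Bounded measurable functions *)

(** The laws [single_draw] and [mkl_scheme] are prescribed only on events: measurable sets of
    circuits together with fixed values of the discrete data. Expectations of functions must be
    recovered from this. All discrete data of one circuit (outcomes and instances) are therefore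
    packed into one element of a finite type, over which everything is a finite sum. Only the
    circuit variable, which ranges over a general measurable space, needs an extension from
    indicators to functions, made one circuit at a time by uniform approximation. Every function
    that is integrated is bounded: unitary entries have modulus at most 1, probabilities lie in
    [0,1], and [gamma'] is bounded by [hgamma]. Boundedness thus replaces all integrability
    arguments and also makes the suprema in the norms finite. Measurability of the ensemble is
    assumed for the channels [uchan (U t)], which determine [U t] only up to a phase; the adjoint
    channel is accordingly expressed through entries of [uchan]. [Minv] is a bare inverse function,
    so its linearity has to be derived. *)

Section BoundedMeasurable.
Context {R : realType} {d : measure_display} {T : measurableType d}.
Implicit Types f g : T -> R.

(** Unlike integrability, this class is stable under products, and it is contained in the integrable
    functions of every probability measure. *)
Definition bounded_measurable f : Prop :=
  measurable_fun setT f /\ exists C, forall x, `|f x| <= C.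

Lemma bounded_measurable_ext f g :
  f =1 g -> bounded_measurable f -> bounded_measurable g.
Proof. by move=> /funext ->. Qed.

Lemma bounded_measurable_cst (c : R) : bounded_measurable (fun=> c).
Proof. by split; [exact: measurable_cst|exists `|c|]. Qed.

Lemma bounded_measurableD f g :
  bounded_measurable f -> bounded_measurable g ->
  bounded_measurable (fun x => f x + g x).
Proof.
move=> [mf [C fC]] [mg [D gD]]; split; first exact: measurable_funD.
by exists (C + D) => x; apply: le_trans (ler_normD _ _) _; apply: lerD.
Qed.

Lemma bounded_measurableM f g :
  bounded_measurable f -> bounded_measurable g ->
  bounded_measurable (fun x => f x * g x).
Proof.
move=> [mf [C fC]] [mg [D gD]]; split; first exact: measurable_funM.
by exists (C * D) => x; rewrite normrM; apply: ler_pM.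
Qed.

Lemma bounded_measurableN f :
  bounded_measurable f -> bounded_measurable (fun x => - f x).
Proof.
move=> [mf [C fC]]; split; first exact: measurableT_comp.
by exists C => x; rewrite normrN.
Qed.

Lemma bounded_measurableX f k :
  bounded_measurable f -> bounded_measurable (fun x => f x ^+ k).
Proof.
move=> [mf [C fC]]; split; first exact: measurable_funX.
by exists (C ^+ k) => x; rewrite normrX lerXn2r ?nnegrE// (le_trans _ (fC x)).
Qed.

Lemma bounded_measurable_sum (J : Type) (s : seq J) (Pr : pred J)
    (F : J -> T -> R) :
  (forall j, bounded_measurable (F j)) ->
  bounded_measurable (fun x => \sum_(j <- s | Pr j) F j x).
Proof.
move=> mF; elim: s => [|j s IH].
  by apply: bounded_measurable_ext (bounded_measurable_cst 0) => x; rewrite big_nil.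
have [Pj|Pj] := boolP (Pr j); last first.
  by apply: bounded_measurable_ext IH => x; rewrite big_cons (negbTE Pj).
apply: bounded_measurable_ext (bounded_measurableD (mF j) IH) => x.
by rewrite big_cons Pj.
Qed.

Lemma bounded_measurable_prod (J : Type) (s : seq J) (Pr : pred J)
    (F : J -> T -> R) :
  (forall j, bounded_measurable (F j)) ->
  bounded_measurable (fun x => \prod_(j <- s | Pr j) F j x).
Proof.
move=> mF; elim: s => [|j s IH].
  by apply: bounded_measurable_ext (bounded_measurable_cst 1) => x; rewrite big_nil.
have [Pj|Pj] := boolP (Pr j); last first.
  by apply: bounded_measurable_ext IH => x; rewrite big_cons (negbTE Pj).
apply: bounded_measurable_ext (bounded_measurableM (mF j) IH) => x.
by rewrite big_cons Pj.
Qed.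

Lemma bounded_measurable_indic (A : set T) :
  measurable A -> bounded_measurable (\1_A : T -> R).
Proof.
move=> mA; split; first exact: measurable_indic.
by exists 1 => x; rewrite indicE; case: (_ \in _); rewrite ?normr1 ?normr0.
Qed.

End BoundedMeasurable.

Lemma bounded_measurable_comp (R : realType) (d d' : measure_display)
    (T : measurableType d) (W : measurableType d') (phi : W -> T) (f : T -> R) :
  measurable_fun setT phi -> bounded_measurable f ->
  bounded_measurable (fun w => f (phi w)).
Proof.
move=> mphi [mf [C fC]]; split; first exact: measurableT_comp.
by exists C => w.
Qed.

(** * Real integrals of bounded functions against a probability *)

Section ProbabilityRintegral.
Context {R : realType} {d : measure_display} {T : measurableType d}.
Variable mu : probability T R.
Implicit Types f g : T -> R.

Lemma bounded_measurable_integrable f :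
  bounded_measurable f -> mu.-integrable setT (EFin \o f).
Proof.
move=> [mf [C fC]]; apply: measurable_bounded_integrable => //.
  by have /= -> := probability_setT mu; rewrite ltry.
exists C; split; first exact: num_real.
by move=> y Cy x _ /=; apply: le_trans (fC x) _; exact: ltW.
Qed.

Lemma EFin_Rintegral f : bounded_measurable f ->
  ((\int[mu]_x f x)%:E = \int[mu]_x (f x)%:E)%E.
Proof.
move=> bf; rewrite /Rintegral fineK//; apply: integrable_fin_num => //.
exact: bounded_measurable_integrable.
Qed.

Lemma prob_RintegralD f g : bounded_measurable f -> bounded_measurable g ->
  \int[mu]_x (f x + g x) = \int[mu]_x f x + \int[mu]_x g x.
Proof. by move=> bf bg; apply: RintegralD => //; exact: bounded_measurable_integrable. Qed.

Lemma prob_RintegralB f g : bounded_measurable f -> bounded_measurable g ->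
  \int[mu]_x (f x - g x) = \int[mu]_x f x - \int[mu]_x g x.
Proof. by move=> bf bg; apply: RintegralB => //; exact: bounded_measurable_integrable. Qed.

Lemma prob_RintegralZl f c : bounded_measurable f ->
  \int[mu]_x (c * f x) = c * \int[mu]_x f x.
Proof. by move=> bf; apply: RintegralZl => //; exact: bounded_measurable_integrable. Qed.

Lemma prob_Rintegral_cst (c : R) : \int[mu]_x c = c.
Proof. by rewrite Rintegral_cst//; have /= -> := probability_setT mu; rewrite mulr1. Qed.

Lemma prob_le_Rintegral f g : bounded_measurable f -> bounded_measurable g ->
  (forall x, f x <= g x) -> \int[mu]_x f x <= \int[mu]_x g x.
Proof.
by move=> bf bg fg; apply: le_Rintegral => //; exact: bounded_measurable_integrable.
Qed.

(** Total mass 1 excludes the empty space. A point is what shows that a bound on an absolute value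
    is nonnegative. *)
Lemma prob_inhabited : inhabited T.
Proof.
case: (pselect (inhabited T)) => // noT; exfalso.
have T0 : [set: T] = set0.
  by apply/seteqP; split=> x // _; apply: noT.
have := probability_setT mu; rewrite T0 measure0 => /eqP.
by rewrite eq_sym onee_eq0.
Qed.

Lemma prob_Rintegral_sum (J : Type) (s : seq J) (Pr : pred J) (F : J -> T -> R) :
  (forall j, bounded_measurable (F j)) ->
  \int[mu]_x (\sum_(j <- s | Pr j) F j x) =
  \sum_(j <- s | Pr j) \int[mu]_x F j x.
Proof.
move=> bF; elim: s => [|j s IH].
  rewrite big_nil -[RHS]prob_Rintegral_cst.
  by apply: eq_Rintegral => x _; rewrite big_nil.
rewrite big_cons -IH; case: ifPn => Pj.
  rewrite -prob_RintegralD//; last exact: bounded_measurable_sum.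
  by apply: eq_Rintegral => x _; rewrite big_cons Pj.
by apply: eq_Rintegral => x _; rewrite big_cons (negbTE Pj).
Qed.

Lemma prob_Rintegral_norm_le f C :
  bounded_measurable f -> (forall x, `|f x| <= C) -> `|\int[mu]_x f x| <= C.
Proof.
move=> bf fC; apply: le_trans (le_normr_Rintegral _ _) _ => //.
  exact: bounded_measurable_integrable.
rewrite -[leRHS]prob_Rintegral_cst; apply: prob_le_Rintegral => //.
  case: bf => mf _; split; first exact: measurableT_comp.
  by exists C => x; rewrite normr_id.
exact: bounded_measurable_cst.
Qed.

Lemma Rintegral_indicM (A : set T) f :
  \int[mu]_x (f x * \1_A x) = \int[mu]_(x in A) f x.
Proof.
rewrite [RHS]Rintegral_mkcond; apply: eq_Rintegral => x _.
by rewrite /patch indicE; case: (_ \in _); rewrite ?mulr1 ?mulr0.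
Qed.

End ProbabilityRintegral.

(** The range, contained in [-C, C], is cut into half-open intervals of length [e], and [h] is
    replaced by the left endpoint of the interval that contains its value. *)
Lemma step_approximation (R : realType) (d : measure_display)
    (T : measurableType d) (h : T -> R) (e : R) :
  0 < e -> bounded_measurable h ->
  exists k (c : 'I_k -> R) (A : 'I_k -> set T),
    (forall j, measurable (A j)) /\
    forall x, `|h x - \sum_(j < k) c j * \1_(A j) x| <= e.
Proof.
move=> e0 [mh [C hC]].
pose u x := (h x + C) / e.
have u0 x : 0 <= u x.
  rewrite divr_ge0 ?(ltW e0)// -lerBlDr sub0r.
  by have := hC x; rewrite ler_norml => /andP[].
have uC x : u x <= 2 * C / e.
  rewrite ler_pM2r ?invr_gt0//.
  by have := hC x; rewrite ler_norml => /andP[_]; lra.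
(* As [u] is at most 2C/e, the floor of 2C/e is the highest possible level; its successor makes
   every level an index in ['I_k]. *)
pose k := (Num.truncn (2 * C / e)).+1.
have uk x : (Num.truncn (u x) < k)%N.
  by rewrite ltnS truncn_le_nat (le_lt_trans (uC x))// truncnS_gt.
pose A (j : 'I_k) := [set x | Num.truncn (u x) = j].
exists k, (fun j : 'I_k => j%:R * e - C), A; split=> [j|x].
  have -> : A j = h @^-1` `[j%:R * e - C, j.+1%:R * e - C[%classic.
    apply/seteqP; split=> x /=; rewrite in_itv/=.
      move=> uj; have /andP := truncn_itv (u0 x); rewrite uj => -[].
      rewrite ler_pdivlMr// ltr_pdivrMr// => ? ?; apply/andP; split; lra.
    move=> /andP[h1 h2]; apply/eqP; rewrite truncn_eq// ler_pdivlMr// ltr_pdivrMr//.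
    by apply/andP; split; lra.
  rewrite -[X in measurable X]setTI; apply: mh => //.
rewrite (bigD1 (Ordinal (uk x)))//= big1 ?addr0; last first.
  move=> j; rewrite -val_eqE/= => jx; rewrite indicE memNset ?mulr0//.
  by move=> Ajx; rewrite /A/= in Ajx; rewrite Ajx eqxx in jx.
rewrite indicE mem_set// mulr1.
have /andP[] := truncn_itv (u0 x).
rewrite ler_pdivlMr// ltr_pdivrMr// -natr1 mulrDl mul1r => h1 h2.
by rewrite ler_norml; apply/andP; split; lra.
Qed.

(** The hypothesis says that [phi] pushes [w] times [P] to [r] times [mu]. Both sides are linear in
    [h] and continuous for uniform convergence, because [w] and [r] are bounded; so step functions
    decide. *)
Lemma Rintegral_transfer (R : realType) (d d' : measure_display)
    (T : measurableType d) (W : measurableType d')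
    (mu : probability T R) (P : probability W R)
    (phi : W -> T) (w : W -> R) (r : T -> R) (h : T -> R) :
  measurable_fun setT phi -> bounded_measurable w -> bounded_measurable r ->
  (forall A, measurable A ->
     \int[P]_x (w x * \1_A (phi x)) = \int[mu]_t (r t * \1_A t)) ->
  bounded_measurable h ->
  \int[P]_x (w x * h (phi x)) = \int[mu]_t (r t * h t).
Proof.
move=> mphi bw br wr bh.
have bcomp (f : T -> R) : bounded_measurable f -> bounded_measurable (fun x => f (phi x)).
  by move=> bf; exact: bounded_measurable_comp mphi bf.
have [_ [Cw wC]] := bw; have [_ [Cr rC]] := br.
have Cw0 : 0 <= Cw by have [x] := prob_inhabited P; exact: le_trans (wC x).
have Cr0 : 0 <= Cr by have [x] := prob_inhabited mu; exact: le_trans (rC x).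
apply/eqP; rewrite -subr_eq0 -normr_le0; apply/ler_addgt0Pl => e e0; rewrite addr0.
(* The two approximation errors add up to at most (Cw + Cr) e'; the extra 1 keeps the divisor
   positive when both bounds are 0. *)
pose e' := e / (Cw + Cr + 1).
have C0 : 0 < Cw + Cr + 1 by lra.
have e'0 : 0 < e' by rewrite divr_gt0.
have [k [c [A [mA hA]]]] := step_approximation e'0 bh.
pose g t := \sum_(j < k) c j * \1_(A j) t.
have b1 j : bounded_measurable (\1_(A j) : T -> R) by exact: bounded_measurable_indic.
have bg : bounded_measurable g.
  by apply: bounded_measurable_sum => j; apply: bounded_measurableM => //; exact: bounded_measurable_cst.
have step : \int[P]_x (w x * g (phi x)) = \int[mu]_t (r t * g t).
  transitivity (\sum_(j < k) c j * \int[P]_x (w x * \1_(A j) (phi x))).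
    rewrite (@eq_Rintegral _ _ _ _ _ (fun x => \sum_(j < k) c j * (w x * \1_(A j) (phi x)))).
      rewrite prob_Rintegral_sum => [|j].
        apply: eq_bigr => j _; rewrite prob_RintegralZl//.
        by apply: bounded_measurableM => //; exact: bcomp.
      apply: bounded_measurableM; first exact: bounded_measurable_cst.
      by apply: bounded_measurableM => //; exact: bcomp.
    by move=> x _; rewrite /g mulr_sumr; apply: eq_bigr => j _; rewrite mulrCA.
  rewrite (@eq_Rintegral _ _ _ _ _ (fun t => \sum_(j < k) c j * (r t * \1_(A j) t))).
    rewrite prob_Rintegral_sum => [|j].
      apply: eq_bigr => j _; rewrite prob_RintegralZl ?wr//.
      exact: bounded_measurableM.
    apply: bounded_measurableM; first exact: bounded_measurable_cst.
    exact: bounded_measurableM.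
  by move=> x _; rewrite /g mulr_sumr; apply: eq_bigr => j _; rewrite mulrCA.
have bhg : bounded_measurable (fun t => h t - g t).
  by apply: bounded_measurableD => //; exact: bounded_measurableN.
have eqW : \int[P]_x (w x * h (phi x)) =
    \int[P]_x (w x * g (phi x)) + \int[P]_x (w x * (h (phi x) - g (phi x))).
  rewrite -prob_RintegralD; first by apply: eq_Rintegral => x _; ring.
  - by apply: bounded_measurableM => //; exact: bcomp.
  - by apply: bounded_measurableM => //; exact: (bcomp _ bhg).
have eqT : \int[mu]_t (r t * h t) =
    \int[mu]_t (r t * g t) + \int[mu]_t (r t * (h t - g t)).
  by rewrite -prob_RintegralD; [apply: eq_Rintegral => x _; ring|exact: bounded_measurableM..].
rewrite eqW eqT step addrAC opprD addrA subrr sub0r addrC.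
apply: le_trans (ler_normB _ _) _.
apply: (@le_trans _ _ (Cw * e' + Cr * e')).
  apply: lerD; apply: prob_Rintegral_norm_le.
  - by apply: bounded_measurableM => //; exact: (bcomp _ bhg).
  - by move=> x; rewrite normrM ler_pM.
  - exact: bounded_measurableM.
  - by move=> x; rewrite normrM ler_pM.
rewrite -mulrDl /e' mulrA ler_pdivrMr// mulrC ler_pM2l//; lra.
Qed.

(** * Independent rounds *)

Section IndependentRounds.
Context {R : realType} {d d' : measure_display}.
Context {T : measurableType d} {W : measurableType d'}.
Variables (mu : probability T R) (P : probability W R).
Variables (M : nat) (Z : finType) (r : T -> Z -> R).
Variables (Uw : 'I_M -> W -> T) (Dw : 'I_M -> W -> Z).
Hypothesis br : forall z, bounded_measurable (r ^~ z).
Hypothesis mU : forall m, measurable_fun setT (Uw m).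
Hypothesis mD : forall m z, measurable (Dw m @^-1` [set z]).
Hypothesis joint_law : forall (A : 'I_M -> set T) (z : 'I_M -> Z),
  (forall m, measurable (A m)) ->
  P [set w | forall m, A m (Uw m w) /\ Dw m w = z m] =
  (\prod_(m < M) \int[mu]_(t in A m) (r t (z m))%:E)%E.

Let D m z : set W := Dw m @^-1` [set z].

Let bD m z : bounded_measurable (\1_(D m z) : W -> R).
Proof. by apply: bounded_measurable_indic; exact: mD. Qed.

(** On each of the finitely many fibres of [Dw m], [F] depends on the circuit alone. *)
Lemma bounded_measurable_round m (F : T -> Z -> R) :
  (forall z, bounded_measurable (F ^~ z)) ->
  bounded_measurable (fun w => F (Uw m w) (Dw m w)).
Proof.
move=> bF.
apply: (@bounded_measurable_ext _ _ _ (fun w => \sum_z \1_(D m z) w * F (Uw m w) z)).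
  move=> w; rewrite (bigD1 (Dw m w))//= big1 ?addr0 => [|z zw].
    by rewrite indicE mem_set// mul1r.
  by rewrite indicE memNset ?mul0r// => /= e; rewrite e eqxx in zw.
apply: bounded_measurable_sum => z; apply: bounded_measurableM => //.
exact: (bounded_measurable_comp (mU m) (bF z)).
Qed.

(** The integrand is the indicator of the event measured by [joint_law], so this is that hypothesis
    in terms of real integrals. *)
Lemma expect_prod_indic (A : 'I_M -> set T) (z : 'I_M -> Z) :
  (forall m, measurable (A m)) ->
  \int[P]_w (\prod_m (\1_(D m (z m)) w * \1_(A m) (Uw m w))) =
  \prod_m \int[mu]_t (r t (z m) * \1_(A m) t).
Proof.
move=> mA.
pose S := [set w | forall m, A m (Uw m w) /\ Dw m w = z m].
have SE : S = \bigcap_(m in [set: 'I_M]) (Uw m @^-1` A m `&` D m (z m)).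
  by apply/seteqP; split=> [w Sw m _|w Sw m]; [split; case: (Sw m)|case: (Sw m I)].
have mS : measurable S.
  rewrite SE; apply: fin_bigcap_measurable; first exact: finite_finset.
  move=> m _; apply: measurableI; last exact: mD.
  by rewrite -[X in measurable X]setTI; apply: mU.
transitivity (\int[P]_w (\1_S w : R)).
  apply: eq_Rintegral => w _; rewrite [RHS]indicE.
  have [Sw|nSw] := boolP (w \in S).
    rewrite big1// => m _; rewrite inE in Sw; case: (Sw m) => Am Dm.
    by rewrite !indicE !mem_set ?mulr1.
  have /existsNP[m Hm] : ~ S w by move=> Sw; rewrite mem_set in nSw.
  rewrite (bigD1 m)//=; rewrite !indicE.
  have [Am|nAm] := pselect (A m (Uw m w)); last by rewrite (memNset nAm) mulr0 mul0r.
  by rewrite memNset ?mul0r// => Dm; apply: Hm.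
rewrite /Rintegral integral_indic// setIT.
have /= := joint_law z mA; rewrite -/S => ->.
rewrite -(@fineK _ 1%E)//.
rewrite (eq_bigr (fun m => (\int[mu]_t (r t (z m) * \1_(A m) t))%:E)).
  by rewrite prodEFin.
move=> m _; rewrite Rintegral_indicM /Rintegral fineK//.
apply: integrable_fin_num => //; apply: integrableS (bounded_measurable_integrable _ (br (z m))) => //.
Qed.

(** Indicators are replaced by bounded functions one circuit at a time: in [claim k], the factors of
    index at least [k] are still indicators. The case 0 is [expect_prod_indic], the case [M] is the
    lemma. *)
Lemma expect_prod_fixed (h : 'I_M -> T -> R) (z : 'I_M -> Z) :
  (forall m, bounded_measurable (h m)) ->
  \int[P]_w (\prod_m (\1_(D m (z m)) w * h m (Uw m w))) =
  \prod_m \int[mu]_t (r t (z m) * h m t).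
Proof.
suff claim k : forall h, (forall m, bounded_measurable (h m)) ->
    (forall m : 'I_M, (k <= m)%N -> exists2 A, measurable A & h m = \1_A) ->
    \int[P]_w (\prod_m (\1_(D m (z m)) w * h m (Uw m w))) =
    \prod_m \int[mu]_t (r t (z m) * h m t).
  by move=> bh; apply: (claim M) => // m; rewrite leqNgt ltn_ord.
elim: k => [|k IH] {}h bh hA.
  have /choice[A HA] : forall m, exists A, measurable A /\ h m = \1_A.
    by move=> m; have [A mA ->] := hA m (leq0n m); exists A.
  have -> : h = fun m => \1_(A m) by apply/funext => m; case: (HA m).
  by apply: expect_prod_indic => m; case: (HA m).
(* Without an index [k] in ['I_M] there is nothing to replace. *)
have [Mk|kM] := leqP M k.
  apply: IH => // m km; have := leq_ltn_trans (leq_trans Mk km) (ltn_ord m).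
  by rewrite ltnn.
pose m0 := Ordinal kM.
(* With an indicator at [m0] the induction hypothesis applies to [h' A]. Freezing the other factors
   into the weight [w0] and the constant [c], it becomes the hypothesis of [Rintegral_transfer] for
   the circuit [m0]. *)
pose h' A m := if m == m0 then \1_A else h m : T -> R.
pose w0 w := \1_(D m0 (z m0)) w * \prod_(m | m != m0) (\1_(D m (z m)) w * h m (Uw m w)).
pose c := \prod_(m | m != m0) \int[mu]_t (r t (z m) * h m t).
have E1 A w : \prod_m (\1_(D m (z m)) w * h' A m (Uw m w)) = w0 w * \1_A (Uw m0 w).
  rewrite (bigD1 m0)//= {1}/h' eqxx /w0 mulrAC; congr (_ * _ * _).
  by apply: eq_bigr => m mm0; rewrite /h' (negbTE mm0).
have E2 A : measurable A -> \prod_m \int[mu]_t (r t (z m) * h' A m t) =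
    \int[mu]_t (c * r t (z m0) * \1_A t).
  move=> mA; rewrite (bigD1 m0)//= {1}/h' eqxx mulrC.
  rewrite (eq_bigr (fun m => \int[mu]_t (r t (z m) * h m t))); last first.
    by move=> m mm0; rewrite /h' (negbTE mm0).
  rewrite -/c -prob_RintegralZl; first by apply: eq_Rintegral => t _; rewrite mulrA.
  by apply: bounded_measurableM => //; exact: bounded_measurable_indic.
rewrite (bigD1 m0)//= mulrC -/c.
transitivity (\int[P]_w (w0 w * h m0 (Uw m0 w))).
  by apply: eq_Rintegral => w _; rewrite (bigD1 m0)//= /w0 mulrAC.
rewrite (@Rintegral_transfer _ _ _ _ _ mu P (Uw m0) w0 (fun t => c * r t (z m0)))//.
- rewrite -prob_RintegralZl; last exact: bounded_measurableM.
  by apply: eq_Rintegral => t _; rewrite mulrA.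
- apply: bounded_measurableM => //; apply: bounded_measurable_prod => m.
  by apply: bounded_measurableM => //; exact: (bounded_measurable_comp (mU m) (bh m)).
- by apply: bounded_measurableM => //; exact: bounded_measurable_cst.
- move=> A mA; rewrite -E2// -IH => [|m|m km].
  + by apply: eq_Rintegral => w _; rewrite E1.
  + by rewrite /h'; case: ifP => // _; exact: bounded_measurable_indic.
  + rewrite /h'; case: ifPn => [_|mm0]; first by exists A.
    by apply: hA; rewrite ltn_neqAle km eq_sym; rewrite -val_eqE in mm0; rewrite mm0.
Qed.

(** Splitting according to the values of all the discrete data reduces to [expect_prod_fixed];
    distributivity turns the sum over choice functions back into a product of sums. *)
Lemma expect_prod (F : 'I_M -> T -> Z -> R) :
  (forall m z, bounded_measurable (F m ^~ z)) ->
  \int[P]_w (\prod_m F m (Uw m w) (Dw m w)) =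
  \prod_m \int[mu]_t (\sum_z r t z * F m t z).
Proof.
move=> bF.
have bDF m z : bounded_measurable (fun w => \1_(D m z) w * F m (Uw m w) z).
  by apply: bounded_measurableM => //; exact: (bounded_measurable_comp (mU m) (bF m z)).
transitivity (\int[P]_w (\sum_(f : {ffun 'I_M -> Z})
    \prod_m (\1_(D m (f m)) w * F m (Uw m w) (f m)))).
  apply: eq_Rintegral => w _.
  rewrite -(bigA_distr_bigA (fun m z => \1_(D m z) w * F m (Uw m w) z)).
  apply: eq_bigr => m _; rewrite (bigD1 (Dw m w))//= big1 ?addr0 => [|z zw].
    by rewrite indicE mem_set// mul1r.
  by rewrite indicE memNset ?mul0r// => /= e; rewrite e eqxx in zw.
rewrite prob_Rintegral_sum => [|f]; last by apply: bounded_measurable_prod => m.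
rewrite (eq_bigr (fun f : {ffun 'I_M -> Z} =>
    \prod_m \int[mu]_t (r t (f m) * F m t (f m)))) => [|f _].
  rewrite -(bigA_distr_bigA (fun m z => \int[mu]_t (r t z * F m t z))).
  apply: eq_bigr => m _; rewrite prob_Rintegral_sum// => z.
  exact: bounded_measurableM.
exact: (@expect_prod_fixed (fun m t => F m t (f m)) f).
Qed.

Hypothesis r1 : forall t, \sum_z r t z = 1.

(** The other rounds are given the factor 1, which integrates to 1 by [r1]. *)
Lemma expect_round m (F : T -> Z -> R) : (forall z, bounded_measurable (F ^~ z)) ->
  \int[P]_w F (Uw m w) (Dw m w) = \int[mu]_t (\sum_z r t z * F t z).
Proof.
move=> bF.
have := @expect_prod (fun j => if j == m then F else fun _ _ => 1).
rewrite (bigD1 m)//= eqxx big1 ?mulr1 => [<-|j /negbTE ->].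
- by apply: eq_Rintegral => w _; rewrite (bigD1 m)//= eqxx big1 ?mulr1// => j /negbTE ->.
- by move=> j z; case: ifP => // _; exact: bounded_measurable_cst.
- rewrite -[RHS](prob_Rintegral_cst mu); apply: eq_Rintegral => t _.
  by rewrite -[RHS](r1 t); apply: eq_bigr => z _; rewrite mulr1.
Qed.

Lemma expect_round2 m m' (F : T -> Z -> R) : m != m' ->
  (forall z, bounded_measurable (F ^~ z)) ->
  \int[P]_w (F (Uw m w) (Dw m w) * F (Uw m' w) (Dw m' w)) =
  (\int[mu]_t (\sum_z r t z * F t z)) ^+ 2.
Proof.
move=> mm' bF; rewrite eq_sym in mm'.
have := @expect_prod (fun j => if (j == m) || (j == m') then F else fun _ _ => 1).
rewrite (bigD1 m)//= (bigD1 m')//= !eqxx orbT /= mulrA -expr2 big1 ?mulr1 => [<-|j].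
- apply: eq_Rintegral => w _; rewrite (bigD1 m)//= (bigD1 m')//= !eqxx orbT /= big1 ?mulr1//.
  by move=> j /andP[/negbTE -> /negbTE ->].
- by move=> j z; case: ifP => // _; exact: bounded_measurable_cst.
- move=> /andP[/negbTE -> /negbTE ->] /=.
  rewrite -[RHS](prob_Rintegral_cst mu); apply: eq_Rintegral => t _.
  by rewrite -[RHS](r1 t); apply: eq_bigr => z _; rewrite mulr1.
Qed.

(** After centring, independence kills the cross terms, leaving 1/M times the variance of one round;
    the square of its mean is then dropped. *)
Lemma variance_mean_rounds (F : T -> Z -> R) : (0 < M)%N ->
  (forall t z, 0 <= r t z) ->
  (forall z, bounded_measurable (F ^~ z)) ->
  ('V_P[(fun w => (\sum_m F (Uw m w) (Dw m w)) / M%:R)%R] <=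
    (M%:R^-1 * \int[mu]_t (\sum_z r t z * F t z ^+ 2))%R%:E)%E.
Proof.
move=> M0 r0 bF.
have M0' : M%:R != 0 :> R by rewrite pnatr_eq0 -lt0n.
pose a := \int[mu]_t (\sum_z r t z * F t z).
pose G t z := F t z - a.
have bG z : bounded_measurable (G ^~ z).
  by apply: bounded_measurableD => //; exact: bounded_measurable_cst.
have brF (H : T -> Z -> R) : (forall z, bounded_measurable (H ^~ z)) ->
    bounded_measurable (fun t => \sum_z r t z * H t z).
  by move=> bH; apply: bounded_measurable_sum => z; exact: bounded_measurableM.
have bF2 z : bounded_measurable (fun t => F t z ^+ 2) by exact: bounded_measurableX.
have G0 : \int[mu]_t (\sum_z r t z * G t z) = 0.
  rewrite (@eq_Rintegral _ _ _ _ _ (fun t => (\sum_z r t z * F t z) - a)).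
    rewrite prob_RintegralB ?prob_Rintegral_cst ?subrr//; first exact: brF.
    exact: bounded_measurable_cst.
  move=> t _; rewrite -[X in _ = _ - X]mul1r -(r1 t) mulr_suml -sumrB.
  by apply: eq_bigr => z _; rewrite mulrBr.
have G2 : \int[mu]_t (\sum_z r t z * G t z ^+ 2) <=
    \int[mu]_t (\sum_z r t z * F t z ^+ 2).
  (* The square of F - a is F^2 - (2aF - a^2), and the subtracted part integrates to a^2. Constants
     enter the sums as multiples of the total mass of [r t]. *)
  rewrite (@eq_Rintegral _ _ _ _ _ (fun t => (\sum_z r t z * F t z ^+ 2) -
      ((2 * a) * (\sum_z r t z * F t z) - a ^+ 2))); last first.
    move=> t _; rewrite -[X in _ = _ - (_ - X)]mul1r -[X in _ - (_ - X * _)](r1 t) mulr_suml mulr_sumr -!sumrB.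
    by apply: eq_bigr => z _; rewrite /G; ring.
  rewrite prob_RintegralB; last 2 first.
  - exact: brF.
  - apply: bounded_measurableD; last exact: bounded_measurable_cst.
    by apply: bounded_measurableM; [exact: bounded_measurable_cst|exact: brF].
  rewrite prob_RintegralB; last 2 first.
  - by apply: bounded_measurableM; [exact: bounded_measurable_cst|exact: brF].
  - exact: bounded_measurable_cst.
  rewrite prob_RintegralZl ?prob_Rintegral_cst; last exact: brF.
  rewrite -/a lerBlDr lerDl; have := sqr_ge0 a; lra.
have EY m : \int[P]_w F (Uw m w) (Dw m w) = a by exact: expect_round.
pose S w := (\sum_m F (Uw m w) (Dw m w)) / M%:R.
have bS : bounded_measurable S.
  apply: bounded_measurableM; last exact: bounded_measurable_cst.
  by apply: bounded_measurable_sum => m; exact: bounded_measurable_round.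
have ES : 'E_P[S]%E = a%:E.
  rewrite expectation.unlock -EFin_Rintegral//; congr EFin.
  rewrite /S (@eq_Rintegral _ _ _ _ _ (fun w => M%:R^-1 * \sum_m F (Uw m w) (Dw m w))); last first.
    by move=> w _; rewrite mulrC.
  have bY m : bounded_measurable (fun w => F (Uw m w) (Dw m w)) by exact: bounded_measurable_round.
  rewrite prob_RintegralZl ?prob_Rintegral_sum//; last exact: bounded_measurable_sum.
  by rewrite (eq_bigr (fun=> a))// sumr_const card_ord -[a *+ M]mulr_natl mulrA mulVf// mul1r.
rewrite /variance covariance.unlock -/S ES /= expectation.unlock.
rewrite (@eq_integral _ _ _ _ _ (fun w => (M%:R^-2 * (\sum_m \sum_m'
     G (Uw m w) (Dw m w) * G (Uw m' w) (Dw m' w)))%:E)); last first.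
  move=> w _; congr EFin; rewrite !fctE /=.
  have -> : S w - a = M%:R^-1 * \sum_m G (Uw m w) (Dw m w).
    rewrite /S /G sumrB sumr_const card_ord mulrBr [_^-1 * _]mulrC; congr (_ - _).
    by rewrite -[a *+ M]mulr_natl mulrA mulVf// mul1r.
  rewrite -expr2 exprMn exprVn; congr (_ * _).
  rewrite expr2 mulr_suml; apply: eq_bigr => m _; by rewrite mulr_sumr.
have bGG m m' : bounded_measurable (fun w => G (Uw m w) (Dw m w) * G (Uw m' w) (Dw m' w)).
  by apply: bounded_measurableM; exact: bounded_measurable_round.
rewrite -EFin_Rintegral; last first.
  apply: bounded_measurableM; first exact: bounded_measurable_cst.
  by do 2![apply: bounded_measurable_sum => ?].
rewrite lee_fin prob_RintegralZl; last by do 2![apply: bounded_measurable_sum => ?].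
rewrite prob_Rintegral_sum => [|m]; last exact: bounded_measurable_sum.
(* Each row of the double sum reduces to its diagonal term, since distinct rounds contribute the
   square of the zero mean [G0]. *)
rewrite (eq_bigr (fun=> \int[mu]_t (\sum_z r t z * G t z ^+ 2))) => [|m _]; last first.
  rewrite prob_Rintegral_sum// (bigD1 m)//= big1 ?addr0 => [|m' m'm].
    rewrite -(@expect_round m (fun t z => G t z ^+ 2))//.
    by move=> z; exact: bounded_measurableX.
  by rewrite expect_round2 1?eq_sym// G0 expr0n.
rewrite sumr_const card_ord -[X in _ * X]mulr_natl expr2 invfM -!mulrA mulKf//.
by rewrite ler_wpM2l// invr_ge0 ler0n.
Qed.

End IndependentRounds.

(** * Moments of the sampling scheme *)

Section IidMoments.
Context {R : realType} {V : finType}.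
Variables (p G : V -> R) (K : nat).
Hypothesis p1 : \sum_v p v = 1.

Lemma iid_expect_prod (u : 'I_K -> V -> R) :
  \sum_(z : {ffun 'I_K -> V}) (\prod_k p (z k)) * \prod_k u k (z k) =
  \prod_k \sum_v p v * u k v.
Proof.
rewrite [RHS](bigA_distr_bigA (fun k v => p v * u k v)).
by apply: eq_bigr => z _; rewrite big_split.
Qed.

Lemma iid_total : \sum_(z : {ffun 'I_K -> V}) \prod_k p (z k) = 1.
Proof.
rewrite -(bigA_distr_bigA (fun (k : 'I_K) v => p v)).
by rewrite big1 => // k _; exact: p1.
Qed.

Lemma iid_expect1 (i : 'I_K) :
  \sum_(z : {ffun 'I_K -> V}) (\prod_k p (z k)) * G (z i) = \sum_v p v * G v.
Proof.
pose u k := if k == i then G else fun=> 1.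
transitivity (\sum_(z : {ffun 'I_K -> V}) (\prod_k p (z k)) * \prod_k u k (z k)).
  apply: eq_bigr => z _; congr (_ * _).
  by rewrite (bigD1 i)//= {1}/u eqxx big1 ?mulr1// => j ji; rewrite /u (negbTE ji).
rewrite iid_expect_prod (bigD1 i)//= {1}/u eqxx [X in _ * X]big1 ?mulr1// => k ki.
by rewrite -[RHS]p1; apply: eq_bigr => v _; rewrite /u (negbTE ki) mulr1.
Qed.

Lemma iid_expect2 (i j : 'I_K) : j != i ->
  \sum_(z : {ffun 'I_K -> V}) (\prod_k p (z k)) * (G (z i) * G (z j)) =
  (\sum_v p v * G v) ^+ 2.
Proof.
move=> ji.
pose u k := if (k == i) || (k == j) then G else fun=> 1.
have uE k : (k != i) && (k != j) -> u k = fun=> 1.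
  by rewrite /u => /andP[/negbTE -> /negbTE ->].
have [ui uj] : u i = G /\ u j = G by rewrite /u !eqxx orbT.
transitivity (\sum_(z : {ffun 'I_K -> V}) (\prod_k p (z k)) * \prod_k u k (z k)).
  apply: eq_bigr => z _; congr (_ * _).
  by rewrite (bigD1 i)//= (bigD1 j)//= ui uj big1 ?mulr1// => k /uE ->.
rewrite iid_expect_prod (bigD1 i)//= (bigD1 j)//= ui uj [X in _ * (_ * X)]big1 ?mulr1// => k /uE ->.
by rewrite -[RHS]p1; apply: eq_bigr => v _; rewrite mulr1.
Qed.

Lemma iid_sum_mean :
  \sum_(z : {ffun 'I_K -> V}) (\prod_k p (z k)) * (\sum_k G (z k)) =
  K%:R * \sum_v p v * G v.
Proof.
under eq_bigr do rewrite mulr_sumr.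
rewrite exchange_big/= (eq_bigr (fun=> \sum_v p v * G v)) => [|i _].
  by rewrite sumr_const card_ord -[LHS]mulr_natl.
exact: iid_expect1.
Qed.

End IidMoments.

(** Of the pairs of indices, K are diagonal and give the second moment; the other K(K - 1) give the
    squared mean. *)
Lemma iid_sum_second_moment (R : realType) (V : finType) (p G : V -> R) (K : nat) :
  \sum_v p v = 1 ->
  \sum_(z : {ffun 'I_K -> V}) (\prod_k p (z k)) * (\sum_k G (z k)) ^+ 2 =
  K%:R * (\sum_v p v * G v ^+ 2) + K%:R * (K%:R - 1) * (\sum_v p v * G v) ^+ 2.
Proof.
move=> p1; set a := \sum_v p v * G v ^+ 2; set b := _ ^+ 2.
rewrite (eq_bigr (fun z : {ffun 'I_K -> V} =>
    \sum_i \sum_j (\prod_k p (z k)) * (G (z i) * G (z j)))); last first.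
  move=> z _; rewrite expr2 mulr_suml mulr_sumr; apply: eq_bigr => i _.
  by rewrite !mulr_sumr.
rewrite exchange_big/= (eq_bigr (fun=> a + (K%:R - 1) * b)) => [|i _].
  by rewrite sumr_const card_ord -[LHS]mulr_natl mulrDr mulrA.
rewrite exchange_big/= (bigD1 i)//=; congr (_ + _).
  by apply: (iid_expect1 (fun v => G v ^+ 2) p1).
rewrite (eq_bigr (fun=> b)) => [|j ji]; last exact: iid_expect2.
rewrite sumr_const -[LHS]mulr_natl; congr (_ * _).
(* The index [i] witnesses that K is positive, so the truncated predecessor agrees with K - 1 in
   [R]. *)
have -> : #|(fun j : 'I_K => j != i)| = K.-1.
  by rewrite -[in RHS](card_ord K) -(cardC1 i); apply: eq_card.
by rewrite -subn1 natrB// (leq_ltn_trans _ (ltn_ord i)).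
Qed.

(** A shot bundled with its L instances is a single i.i.d. draw, of law [pi]. The one-level formula
    is applied to the shots, then again to the instances inside the second moment. *)
Lemma nested_sum_second_moment (R : realType) (X Y : finType)
    (p : X -> R) (q : Y -> R) (h : X -> Y -> R) (K L : nat) :
  \sum_x p x = 1 -> \sum_y q y = 1 ->
  \sum_(z : {ffun 'I_K -> X * {ffun 'I_L -> Y}})
     (\prod_k (p (z k).1 * \prod_l q ((z k).2 l))) *
     (\sum_k \sum_l h (z k).1 ((z k).2 l)) ^+ 2 =
  K%:R * (L%:R * (\sum_x p x * \sum_y q y * h x y ^+ 2) +
          L%:R * (L%:R - 1) * (\sum_x p x * (\sum_y q y * h x y) ^+ 2)) +
  K%:R * (K%:R - 1) * (L%:R * \sum_x p x * \sum_y q y * h x y) ^+ 2.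
Proof.
move=> p1 q1.
pose pi (v : X * {ffun 'I_L -> Y}) := p v.1 * \prod_l q (v.2 l).
pose G (v : X * {ffun 'I_L -> Y}) := \sum_l h v.1 (v.2 l).
have sumE (F : X -> {ffun 'I_L -> Y} -> R) :
    \sum_v pi v * F v.1 v.2 = \sum_x p x * \sum_(y : {ffun 'I_L -> Y}) (\prod_l q (y l)) * F x y.
  under [RHS]eq_bigr do rewrite mulr_sumr.
  by rewrite pair_big/=; apply: eq_bigr => v _; rewrite /pi mulrA.
have pi1 : \sum_v pi v = 1.
  have := sumE (fun _ _ => 1); under eq_bigr do rewrite mulr1.
  move=> ->; rewrite -[RHS]p1; apply: eq_bigr => x _.
  by under eq_bigr do rewrite mulr1; rewrite iid_total// mulr1.
have := iid_sum_second_moment G K pi1; rewrite /G /pi /= => ->.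
rewrite -/pi (sumE (fun x (y : {ffun 'I_L -> Y}) => (\sum_l h x (y l)) ^+ 2)) (sumE (fun x (y : {ffun 'I_L -> Y}) => \sum_l h x (y l))).
congr (_ * _ + _ * _ ^+ 2).
  rewrite !mulr_sumr -big_split/=; apply: eq_bigr => x _.
  by rewrite iid_sum_second_moment// mulrDr; congr (_ + _); rewrite mulrCA.
rewrite mulr_sumr; apply: eq_bigr => x _.
by rewrite iid_sum_mean// mulrCA.
Qed.

(** * The sampling schemes as independent rounds *)

Section Sampling.
Context {R : realType} {d d' : measure_display}.
Context {T : measurableType d} {W : measurableType d'}.
Variables (mu : probability T R) (P : probability W R).
Variables (N : nat) (I : finType) (p : T -> 'I_N -> R) (q : T -> I -> R).
Hypothesis bp : forall x, bounded_measurable (p ^~ x).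
Hypothesis bq : forall y, bounded_measurable (q ^~ y).
Hypothesis p0 : forall t x, 0 <= p t x.
Hypothesis q0 : forall t y, 0 <= q t y.
Hypothesis p1 : forall t, \sum_x p t x = 1.
Hypothesis q1 : forall t, \sum_y q t y = 1.
Variable h : T -> 'I_N -> I -> R.
Hypothesis bh : forall x y, bounded_measurable (fun t => h t x y).

(** A single draw is the case of one round, with the pair (outcome, instance) as its discrete
    data. *)
Lemma expect_single_draw (Uw : W -> T) (bw : W -> 'I_N) (Bw : W -> I) :
  single_draw mu p q P Uw bw Bw ->
  ('E_P[fun w => h (Uw w) (bw w) (Bw w)] =
   (\int[mu]_t (\sum_x p t x * \sum_y q t y * h t x y))%:E)%E.
Proof.
move=> [mU mb mB law].
pose r t (z : 'I_N * I) := p t z.1 * q t z.2.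
pose D (m : 'I_1) w := (bw w, Bw w).
have br z : bounded_measurable (r ^~ z) by exact: bounded_measurableM.
have mD m z : measurable (D m @^-1` [set z]).
  have -> : D m @^-1` [set z] = bw @^-1` [set z.1] `&` Bw @^-1` [set z.2].
    by apply/seteqP; split=> w; rewrite /D/=; case: z => x y /= [-> ->].
  exact: measurableI.
have joint (A : 'I_1 -> set T) (z : 'I_1 -> 'I_N * I) : (forall m, measurable (A m)) ->
    P [set w | forall m, A m (Uw w) /\ D m w = z m] =
    (\prod_(m < 1) \int[mu]_(t in A m) (r t (z m))%:E)%E.
  move=> mA; rewrite big_ord1 -law//; congr (P _); apply/seteqP; split=> w /=.
    by move=> /(_ ord0)[A0 Dz]; rewrite -Dz.
  by move=> [A0 zb zB] m; rewrite ord1; split=> //; rewrite /D zb zB; case: (z 0).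
rewrite expectation.unlock -EFin_Rintegral; last first.
  exact: (@bounded_measurable_round _ _ _ _ _ _ _ (fun=> Uw) D (fun=> mU) mD ord0
    (fun t z => h t z.1 z.2)).
congr EFin.
rewrite (@expect_round _ _ _ _ _ mu P _ _ r (fun=> Uw) D br (fun=> mU) mD joint _
   ord0 (fun t z => h t z.1 z.2))//.
  apply: eq_Rintegral => t _; under [RHS]eq_bigr do rewrite mulr_sumr.
  by rewrite pair_big/=; apply: eq_bigr => v _; rewrite mulrA.
move=> t; rewrite -[RHS](p1 t) -[RHS]mulr1 -(q1 t) mulr_suml.
under [RHS]eq_bigr do rewrite mulr_sumr.
by rewrite pair_big.
Qed.

(** One round consists of a circuit with all its K shots and KL instances. Its second moment is
    computed conditionally on the circuit, where [nested_sum_second_moment] applies to [p t] and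
    [q t]. *)
Lemma variance_mkl_scheme (M K L : nat) (Uw : 'I_M -> W -> T)
    (bw : 'I_M -> 'I_K -> W -> 'I_N) (Bw : 'I_M -> 'I_K -> 'I_L -> W -> I) :
  (0 < M)%N -> (0 < K)%N -> (0 < L)%N ->
  mkl_scheme mu p q P Uw bw Bw ->
  ('V_P[(fun w => (\sum_(m < M) \sum_(k < K) \sum_(l < L)
         h (Uw m w) (bw m k w) (Bw m k l w)) / (M * K * L)%:R)%R] <=
   (M%:R^-1 * \int[mu]_t
      (K%:R^-1 * (L%:R^-1 * (\sum_x p t x * \sum_y q t y * h t x y ^+ 2) +
                  (1 - L%:R^-1) * (\sum_x p t x * (\sum_y q t y * h t x y) ^+ 2)) +
       (1 - K%:R^-1) * (\sum_x p t x * \sum_y q t y * h t x y) ^+ 2))%R%:E)%E.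
Proof.
move=> M0 K0 L0 [mU mb mB law].
pose Z := {ffun 'I_K -> 'I_N * {ffun 'I_L -> I}}.
pose r t (z : Z) := \prod_k (p t (z k).1 * \prod_l q t ((z k).2 l)).
pose D (m : 'I_M) w : Z := [ffun k => (bw m k w, [ffun l => Bw m k l w])].
pose F t (z : Z) := (\sum_k \sum_l h t (z k).1 ((z k).2 l)) / (K * L)%:R.
have K0' : K%:R != 0 :> R by rewrite pnatr_eq0 -lt0n.
have L0' : L%:R != 0 :> R by rewrite pnatr_eq0 -lt0n.
have M0' : M%:R != 0 :> R by rewrite pnatr_eq0 -lt0n.
have DP m w z : D m w = z <->
    forall k, bw m k w = (z k).1 /\ forall l, Bw m k l w = (z k).2 l.
  split=> [<- k|Hz]; first by rewrite !ffunE/=; split=> // l; rewrite ffunE.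
  apply/ffunP => k; rewrite ffunE; have [-> Hl] := Hz k.
  rewrite [RHS]surjective_pairing; congr (_, _).
  by apply/ffunP => l; rewrite ffunE.
have br z : bounded_measurable (r ^~ z).
  apply: bounded_measurable_prod => k; apply: bounded_measurableM => //.
  exact: bounded_measurable_prod.
have mD m z : measurable (D m @^-1` [set z]).
  have -> : D m @^-1` [set z] = \bigcap_(k in [set: 'I_K])
      (bw m k @^-1` [set (z k).1] `&`
       \bigcap_(l in [set: 'I_L]) (Bw m k l @^-1` [set (z k).2 l])).
    apply/seteqP; split=> w.
      by move=> /DP Hz k _; have [Hb HB] := Hz k; split=> [|l _]; [exact: Hb|exact: HB].
    by move=> Hz; apply/DP => k; have [Hb HB] := Hz k Logic.I; split=> // l; apply: HB.
  apply: fin_bigcap_measurable; first exact: finite_finset.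
  move=> k _; apply: measurableI; first exact: mb.
  apply: fin_bigcap_measurable => [|l _]; first exact: finite_finset.
  exact: mB.
have joint (A : 'I_M -> set T) (z : 'I_M -> Z) : (forall m, measurable (A m)) ->
    P [set w | forall m, A m (Uw m w) /\ D m w = z m] =
    (\prod_(m < M) \int[mu]_(t in A m) (r t (z m))%:E)%E.
  move=> mA.
  rewrite -(law A (fun m k => (z m k).1) (fun m k l => (z m k).2 l))//.
  congr (P _); apply/seteqP; split=> w /= Hw m; have [Am Hm] := Hw m; split=> //.
    by apply/DP.
  exact/DP.
have r0 t z : 0 <= r t z.
  by apply: prodr_ge0 => k _; apply: mulr_ge0 => //; apply: prodr_ge0.
have r1 t : \sum_z r t z = 1.
  rewrite /r (iid_total K (p := fun v : 'I_N * {ffun 'I_L -> I} =>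
    p t v.1 * \prod_l q t (v.2 l)))//.
  rewrite -(pair_big xpredT xpredT (fun x (y : {ffun 'I_L -> I}) => p t x * \prod_l q t (y l)))/=.
  rewrite -[RHS](p1 t); apply: eq_bigr => x _.
  by rewrite -mulr_sumr iid_total// mulr1.
have bF z : bounded_measurable (F ^~ z).
  apply: bounded_measurableM; last exact: bounded_measurable_cst.
  by do 2![apply: bounded_measurable_sum => ?].
have := @variance_mean_rounds _ _ _ _ _ mu P _ _ r Uw D br mU mD joint r1 F M0 r0 bF.
congr (_ <= _)%E; last congr (_ * _)%:E.
  congr variance; apply/funext => w.
  rewrite /F -mulr_suml -mulnA [in RHS]natrM [in RHS]invfM [RHS]mulrA [RHS]mulrAC; congr (_ / _ / _).
  apply: eq_bigr => m _; apply: eq_bigr => k _; apply: eq_bigr => l _.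
  by rewrite !ffunE.
apply: eq_Rintegral => t _.
rewrite (eq_bigr (fun z : Z => (K * L)%:R^-1 ^+ 2 *
    (r t z * (\sum_k \sum_l h t (z k).1 ((z k).2 l)) ^+ 2))); last first.
  by move=> z _; rewrite /F exprMn mulrA mulrC.
rewrite -mulr_sumr nested_sum_second_moment// natrM.
set a := \sum_x _ * \sum_y _ * _ ^+ 2; set b := \sum_x _ * _ ^+ 2.
set c := \sum_x _ * \sum_y _ * h _ _ _.
by field; rewrite K0' L0'.
Qed.

End Sampling.

(** * Superoperators *)

Section ComplexParts.
Context {R : realType}.
Implicit Types x y : R[i].

Lemma Re_add x y : complex.Re (x + y) = complex.Re x + complex.Re y.
Proof. by case: x y => [? ?] [? ?]. Qed.

Lemma Im_add x y : complex.Im (x + y) = complex.Im x + complex.Im y.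
Proof. by case: x y => [? ?] [? ?]. Qed.

Lemma Re_mul x y :
  complex.Re (x * y) = complex.Re x * complex.Re y - complex.Im x * complex.Im y.
Proof. by case: x y => [? ?] [? ?]. Qed.

Lemma Im_mul x y :
  complex.Im (x * y) = complex.Re x * complex.Im y + complex.Im x * complex.Re y.
Proof. by case: x y => [? ?] [? ?]. Qed.

Lemma Re_realM (a : R) y : complex.Re (a%:C * y) = a * complex.Re y.
Proof. by rewrite Re_mul /= mul0r subr0. Qed.

Lemma Re_sum (J : finType) (F : J -> R[i]) :
  complex.Re (\sum_j F j) = \sum_j complex.Re (F j).
Proof. by elim/big_rec2: _ => // j a b _ <-; rewrite Re_add. Qed.

Lemma Im_sum (J : finType) (F : J -> R[i]) :
  complex.Im (\sum_j F j) = \sum_j complex.Im (F j).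
Proof. by elim/big_rec2: _ => // j a b _ <-; rewrite Im_add. Qed.

Lemma Re_Im_norm_le x (C : R) : `|x| <= C%:C ->
  `|complex.Re x| <= C /\ `|complex.Im x| <= C.
Proof.
rewrite normc_def lecR => xC.
by split; apply: le_trans xC; rewrite -sqrtr_sqr ler_wsqrtr// ?lerDl ?lerDr sqr_ge0.
Qed.

End ComplexParts.

(** * Complex functions whose two parts lie in a ring of real functions *)

Section Componentwise.
Context {R : realType} {T : Type}.

(** Lets closure be proved once for two classes: bounded measurable functions, for what is built
    from the circuit, and measurable functions, for the noise [E], which is only assumed
    measurable. *)
Record function_ring (S : (T -> R) -> Prop) : Prop := FunctionRing {
  function_ring_cst : forall c, S (fun=> c);
  function_ringD : forall f g, S f -> S g -> S (fun t => f t + g t);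
  function_ringN : forall f, S f -> S (fun t => - f t);
  function_ringM : forall f g, S f -> S g -> S (fun t => f t * g t) }.

Definition componentwise (S : (T -> R) -> Prop) (f : T -> R[i]) : Prop :=
  S (fun t => complex.Re (f t)) /\ S (fun t => complex.Im (f t)).

Variable S : (T -> R) -> Prop.
Hypothesis ringS : function_ring S.

Lemma function_ring_sum (J : finType) (F : J -> T -> R) :
  (forall j, S (F j)) -> S (fun t => \sum_j F j t).
Proof.
move=> SF; elim: (index_enum J) => [|j s IH].
  by under eq_fun do rewrite big_nil; exact: function_ring_cst.
by under eq_fun do rewrite big_cons; exact: function_ringD.
Qed.

Lemma componentwise_cst (c : R[i]) : componentwise S (fun=> c).
Proof. by split; exact: function_ring_cst. Qed.

Lemma componentwiseM (f g : T -> R[i]) :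
  componentwise S f -> componentwise S g -> componentwise S (fun t => f t * g t).
Proof.
move=> [fr fi] [gr gi]; split.
  under eq_fun do rewrite Re_mul.
  by apply: function_ringD => //; [|apply: function_ringN => //]; exact: function_ringM.
under eq_fun do rewrite Im_mul.
by apply: function_ringD => //; exact: function_ringM.
Qed.

Lemma componentwise_sum (J : finType) (F : J -> T -> R[i]) :
  (forall j, componentwise S (F j)) -> componentwise S (fun t => \sum_j F j t).
Proof.
move=> SF; split.
  by under eq_fun do rewrite Re_sum; apply: function_ring_sum => j; case: (SF j).
by under eq_fun do rewrite Im_sum; apply: function_ring_sum => j; case: (SF j).
Qed.

End Componentwise.

Lemma measurable_function_ring (R : realType) (d : measure_display)
    (T : measurableType d) : function_ring (fun f : T -> R => measurable_fun setT f).
Proof.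
split=> [c|f g mf mg|f mf|f g mf mg].
- exact: measurable_cst.
- exact: measurable_funD.
- exact: measurable_funN.
- exact: measurable_funM.
Qed.

Lemma bounded_measurable_function_ring (R : realType) (d : measure_display)
    (T : measurableType d) : function_ring (@bounded_measurable R d T).
Proof.
split.
- exact: bounded_measurable_cst.
- exact: bounded_measurableD.
- exact: bounded_measurableN.
- exact: bounded_measurableM.
Qed.

Lemma mulmx_delta (K : pzRingType) (m n p q : nat) (A : 'M[K]_(m, n))
    (B : 'M[K]_(p, q)) i j k l :
  (A *m delta_mx i j *m B) k l = A k i * B j l.
Proof.
have AE a : (A *m delta_mx i j) k a = A k i *+ (a == j).
  rewrite mxE (bigD1 i)//= big1 ?addr0 => [|c ci].
    by rewrite mxE eqxx /= mulr_natr.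
  by rewrite mxE (negbTE ci) mulr0.
rewrite mxE (bigD1 j)//= big1 ?addr0 => [|a aj]; first by rewrite AE eqxx.
by rewrite AE (negbTE aj) mul0r.
Qed.

Lemma conjugate_transposeK (K : numClosedFieldType) (m n : nat) (A : 'M[K]_(m, n)) :
  (A^t*)^t* = A.
Proof. by apply/matrixP => i j; rewrite !mxE conjCK. Qed.

Section Superoperators.
Context {R : realType} {N : nat}.
Local Notation C := R[i].
Implicit Types (X Y rho : 'M[C]_N) (V : 'M[C]_N).

Lemma hsdot_ketbra (b : 'I_N) X : hsdot (ketbra R b) X = X b b.
Proof.
rewrite /hsdot /ketbra trmx_delta map_delta_mx mxtrace_mulC -[delta_mx b b]mulmx1.
rewrite mulmxA /mxtrace (bigD1 b)//= mulmx_delta big1 ?addr0 => [|i ib].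
  by rewrite mxE eqxx mulr1n mulr1.
by rewrite mulmx_delta mxE eq_sym (negbTE ib) mulr0n mulr0.
Qed.

Lemma meas_channelE X i j : meas_channel X i j = X i i *+ (i == j).
Proof.
rewrite /meas_channel summxE (bigD1 i)//= big1 ?addr0 => [|b bi].
  by rewrite hsdot_ketbra !mxE eqxx /= mulr_natr eq_sym.
by rewrite !mxE (eq_sym i) (negbTE bi) mulr0.
Qed.

Lemma uchan_is_linear V : linear (uchan V).
Proof. by move=> a X Y; rewrite /uchan mulmxDr mulmxDl -scalemxAr -scalemxAl. Qed.
HB.instance Definition _ V := GRing.isLinear.Build C _ _ _ (uchan V) (uchan_is_linear V).

Lemma uchan_dag_is_linear V : linear (uchan_dag V).
Proof. by move=> a X Y; rewrite /uchan_dag mulmxDr mulmxDl -scalemxAr -scalemxAl. Qed.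
HB.instance Definition _ V :=
  GRing.isLinear.Build C _ _ _ (uchan_dag V) (uchan_dag_is_linear V).

Lemma meas_channel_is_linear : linear (@meas_channel R N).
Proof.
by move=> a X Y; apply/matrixP => i j; rewrite !(meas_channelE, mxE) mulrnDl mulrnAr.
Qed.
HB.instance Definition _ :=
  GRing.isLinear.Build C _ _ _ (@meas_channel R N) meas_channel_is_linear.

Lemma hsdot_is_linear (O : 'M[C]_N) : linear_for *%R (hsdot O).
Proof. by move=> a X Y; rewrite /hsdot mulmxDr mxtraceD -scalemxAr mxtraceZ. Qed.
HB.instance Definition _ (O : 'M[C]_N) :=
  GRing.isLinear.Build C _ _ _ (hsdot O) (hsdot_is_linear O).

(** [measurable_superop] concerns a fixed argument; expanding over matrix units extends it to
    arguments that vary with the circuit. *)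
Lemma linear_delta_expand (f : {linear 'M[C]_N -> 'M[C]_N}) X i j :
  f X i j = \sum_k \sum_l X k l * f (delta_mx k l) i j.
Proof.
rewrite {1}(matrix_sum_delta X) linear_sum summxE; apply: eq_bigr => k _.
rewrite linear_sum summxE; apply: eq_bigr => l _.
by rewrite linearZ !mxE.
Qed.

Lemma linear_form_delta_expand (f : {linear 'M[C]_N -> C | *%R}) X :
  f X = \sum_k \sum_l X k l * f (delta_mx k l).
Proof.
rewrite {1}(matrix_sum_delta X) linear_sum; apply: eq_bigr => k _.
by rewrite linear_sum; apply: eq_bigr => l _; rewrite linearZ.
Qed.

(** Duality of the two channels against a matrix unit. It transfers measurability and bounds from
    [uchan] to its adjoint without assumptions on the entries of the unitary. *)
Lemma uchan_dag_entry V X i j :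
  uchan_dag V X i j = \sum_l \sum_k X k l * uchan V (delta_mx j i) l k.
Proof.
rewrite /uchan_dag mxE; apply: eq_bigr => l _.
rewrite mxE mulr_suml; apply: eq_bigr => k _.
by rewrite /uchan mulmx_delta !mxE; ring.
Qed.

(** The squared moduli in row [i] sum to 1. *)
Lemma unitarymx_entry_le1 V i j : V \is unitarymx -> `|V i j| <= 1.
Proof.
move=> /unitarymxP VV.
have : (V *m V^t*) i i = 1 by rewrite VV mxE eqxx.
rewrite mxE (bigD1 j)//= !mxE -normCK => V1.
rewrite -(@expr_le1 _ 2)// -V1 lerDl sumr_ge0// => k _.
by rewrite !mxE -normCK exprn_ge0.
Qed.

Lemma mxtrace_uchan V X : V \is unitarymx -> \tr (uchan V X) = \tr X.
Proof.
by move=> Vu; rewrite /uchan mxtrace_mulC mulmxA -[_ *m V]mul1mx mulmxA mulmxKtV ?mul1mx.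
Qed.

Lemma psd_uchan V X : psd X -> psd (uchan V X).
Proof.
move=> Xpsd v; have := Xpsd (V^t* *m v).
have -> : (V^t* *m v)^t* = v^t* *m V by rewrite trmx_mul map_mxM conjugate_transposeK.
by rewrite /uchan !mulmxA.
Qed.

Lemma psd_diag_ge0 X b : psd X -> 0 <= X b b.
Proof.
move=> /(_ (delta_mx b 0)); congr (0 <= _).
by rewrite trmx_delta map_delta_mx -rowE -colE !mxE.
Qed.

(** This is the case of one block. The ampliation acts on matrices of size [\sum_(i < 1) N], so
    positivity is carried through the block structure in both directions. *)
Lemma completely_positive_psd (Phi : 'M[C]_N -> 'M[C]_N) X :
  completely_positive Phi -> psd X -> psd (Phi X).
Proof.
move=> /(_ 1%N) cp Xpsd.
have map_mxrow (v : 'cV[C]_(\sum_(i < 1) N)) :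
    v^t* = \mxrow_(i < 1) (submxcol v i)^t*.
  rewrite -{1}(submxcolK v) tr_mxcol.
  by apply/matrixP => i j; rewrite !mxE.
(* The quadratic form of a matrix with a single block is that of the block. *)
have form (B : 'I_1 -> 'I_1 -> 'M[C]_N) (v : 'cV[C]_(\sum_(i < 1) N)) :
    (v^t* *m (\mxblock_(i < 1, j < 1) B i j) *m v) =
    ((submxcol v 0)^t* *m B 0 0 *m submxcol v 0).
  rewrite map_mxrow mul_mxrow_mxblock -{2}(submxcolK v) mul_mxrow_mxcol.
  by rewrite !big_ord1.
move=> v.
have /cp /(_ (\mxcol_(i < 1) v)) : psd (\mxblock_(i < 1, j < 1) X).
  by move=> w; rewrite form; exact: Xpsd.
by rewrite /ampliation form mxblockK mxcolK.
Qed.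

(** Provides a state, so that a supremum over states is not taken over the empty set. *)
Lemma density_ketbra (b : 'I_N) : density (ketbra R b).
Proof.
split; last first.
  rewrite /ketbra /mxtrace (bigD1 b)//= big1 ?addr0 => [|i ib]; first by rewrite mxE eqxx.
  by rewrite mxE (negbTE ib).
move=> v; rewrite mulmx_delta !mxE mulrC mul_conjC_ge0 //.
Qed.

End Superoperators.

(** * The shadow map *)

Section ComplexExpectation.
Context {R : realType} {d : measure_display} {T : measurableType d}.
Variable mu : probability T R.
Implicit Types f g : T -> R[i].

Local Notation bounded := (componentwise (@bounded_measurable R d T)).

Definition complex_expect f : R[i] :=
  (\int[mu]_t complex.Re (f t)) +i* (\int[mu]_t complex.Im (f t)).

Lemma complex_expectD f g : bounded f -> bounded g ->
  complex_expect (fun t => f t + g t) = complex_expect f + complex_expect g.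
Proof.
move=> [fr fi] [gr gi]; rewrite /complex_expect; apply/eqP; rewrite eq_complex /=.
apply/andP; split; apply/eqP.
  rewrite -prob_RintegralD//; apply: eq_Rintegral => t _; exact: Re_add.
rewrite -prob_RintegralD//; apply: eq_Rintegral => t _; exact: Im_add.
Qed.

Lemma complex_expectMr f (c : R[i]) : bounded f ->
  complex_expect (fun t => f t * c) = complex_expect f * c.
Proof.
move=> [fr fi]; case: c => a b; rewrite /complex_expect; apply/eqP; rewrite eq_complex /=.
have bM (g : T -> R) (c : R) : bounded_measurable g -> bounded_measurable (fun t => c * g t).
  by move=> bg; apply: bounded_measurableM => //; exact: bounded_measurable_cst.
apply/andP; split; apply/eqP.
  rewrite [_ * a]mulrC [_ * b]mulrC -!prob_RintegralZl// -prob_RintegralB; [|exact: bM..].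
  by apply: eq_Rintegral => t _; rewrite Re_mul /=; ring.
rewrite [_ * a]mulrC [_ * b]mulrC -!prob_RintegralZl// -prob_RintegralD; [|exact: bM..].
by apply: eq_Rintegral => t _; rewrite Im_mul /=; ring.
Qed.

Lemma complex_expect_sum (J : finType) (F : J -> T -> R[i]) :
  (forall j, bounded (F j)) ->
  complex_expect (fun t => \sum_j F j t) = \sum_j complex_expect (F j).
Proof.
move=> bF; apply/eqP; rewrite eq_complex Re_sum Im_sum /=; apply/andP; split; apply/eqP.
  rewrite -prob_Rintegral_sum => [|j]; last by case: (bF j).
  by apply: eq_Rintegral => t _; rewrite Re_sum.
rewrite -prob_Rintegral_sum => [|j]; last by case: (bF j).
by apply: eq_Rintegral => t _; rewrite Im_sum.
Qed.

(** A linear form is a finite combination of entries, and the expectation is taken entrywise. *)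
Lemma linear_form_expect_mx (N : nat) (L : {linear 'M[R[i]]_N -> R[i] | *%R})
    (F : T -> 'M[R[i]]_N) :
  (forall i j, bounded (fun t => F t i j)) ->
  L (expect_mx mu F) = complex_expect (fun t => L (F t)).
Proof.
move=> bF; have ringB := @bounded_measurable_function_ring R d T.
rewrite linear_form_delta_expand.
under [in RHS]eq_fun do rewrite linear_form_delta_expand.
have bFL k l : bounded (fun t => F t k l * L (delta_mx k l)).
  by apply: componentwiseM => //; exact: componentwise_cst.
rewrite complex_expect_sum => [|k]; last exact: componentwise_sum.
apply: eq_bigr => k _; rewrite complex_expect_sum//; apply: eq_bigr => l _.
by rewrite complex_expectMr// mxE.
Qed.

End ComplexExpectation.

(** * Regularity of superoperators in the circuit variable *)

Section MeasurableSuperoperators.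
Context {R : realType} {N : nat} {T : Type}.
Variable S : (T -> R) -> Prop.
Hypothesis ringS : function_ring S.
Implicit Type F : T -> 'M[R[i]]_N.

Lemma componentwise_meas_channel F i j :
  (forall i j, componentwise S (fun t => F t i j)) ->
  componentwise S (fun t => meas_channel (F t) i j).
Proof.
move=> SF; under eq_fun do rewrite meas_channelE -mulr_natr.
by apply: componentwiseM => //; exact: componentwise_cst.
Qed.

Lemma componentwise_linear_form (L : {linear 'M[R[i]]_N -> R[i] | *%R}) F :
  (forall i j, componentwise S (fun t => F t i j)) ->
  componentwise S (fun t => L (F t)).
Proof.
move=> SF; under eq_fun do rewrite linear_form_delta_expand.
apply: componentwise_sum => // k; apply: componentwise_sum => // l.
by apply: componentwiseM => //; exact: componentwise_cst.
Qed.

Lemma componentwise_linear (A : T -> {linear 'M[R[i]]_N -> 'M[R[i]]_N}) F i j :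
  (forall k l, componentwise S (fun t => A t (delta_mx k l) i j)) ->
  (forall i j, componentwise S (fun t => F t i j)) ->
  componentwise S (fun t => A t (F t) i j).
Proof.
move=> SA SF; under eq_fun do rewrite linear_delta_expand.
apply: componentwise_sum => // k; apply: componentwise_sum => // l.
exact: componentwiseM.
Qed.

Variable U : T -> 'M[R[i]]_N.
Hypothesis SU : forall k l i j, componentwise S (fun t => uchan (U t) (delta_mx k l) i j).

Lemma componentwise_uchan X i j : componentwise S (fun t => uchan (U t) X i j).
Proof.
pose A t : {linear 'M[R[i]]_N -> 'M[R[i]]_N} := uchan (U t).
apply: (@componentwise_linear A (fun=> X) i j) => [k l|k l]; first exact: SU.
exact: componentwise_cst.
Qed.

Lemma componentwise_uchan_dag F i j :
  (forall i j, componentwise S (fun t => F t i j)) ->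
  componentwise S (fun t => uchan_dag (U t) (F t) i j).
Proof.
move=> SF; under eq_fun do rewrite uchan_dag_entry.
apply: componentwise_sum => // k; apply: componentwise_sum => // l.
exact: componentwiseM.
Qed.

End MeasurableSuperoperators.

Section ShadowMap.
Context {R : realType} {N : nat} {d : measure_display} {T : measurableType d}.
Variables (mu : probability T R) (U : T -> 'M[R[i]]_N).
Hypothesis hU : forall t, U t \is unitarymx.
Hypothesis hUmeas : measurable_superop (fun t => uchan (U t)).

Local Notation bounded := (componentwise (@bounded_measurable R d T)).
Let ringB := @bounded_measurable_function_ring R d T.

(** The entry is a product of one entry of the unitary and one conjugate entry, each of modulus at
    most 1. *)
Lemma bounded_uchan_delta k l i j :
  bounded (fun t => uchan (U t) (delta_mx k l) i j).
Proof.
have le1 t : `|uchan (U t) (delta_mx k l) i j| <= 1%:C.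
  rewrite /uchan mulmx_delta !mxE normrM norm_conjC.
  by rewrite mulr_ile1 ?unitarymx_entry_le1.
have [mR mI] := hUmeas (delta_mx k l) i j.
by split; split=> //; exists 1 => t; have [] := Re_Im_norm_le (le1 t).
Qed.

Definition shadow_integrand X t := uchan_dag (U t) (meas_channel (uchan (U t) X)).

Lemma bounded_shadow_integrand X i j : bounded (fun t => shadow_integrand X t i j).
Proof.
apply: componentwise_uchan_dag => //; first exact: bounded_uchan_delta.
move=> k l; apply: componentwise_meas_channel => // {}k {}l.
by apply: componentwise_uchan => //; exact: bounded_uchan_delta.
Qed.

Lemma shadow_map_is_linear : linear (shadow_map mu U).
Proof.
move=> a X Y; apply/matrixP => i j.
have shadowE Z : shadow_map mu U Z i j = complex_expect mu (fun t => shadow_integrand Z t i j).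
  by rewrite /shadow_map /expect_mx mxE.
have bX := bounded_shadow_integrand X i j; have bY := bounded_shadow_integrand Y i j.
have bXa : bounded (fun t => shadow_integrand X t i j * a).
  by apply: componentwiseM => //; exact: componentwise_cst.
have entryP (A B : 'M[R[i]]_N) : (a *: A + B) i j = A i j * a + B i j.
  by rewrite !mxE mulrC.
apply: etrans (shadowE _) _; apply: esym; apply: etrans (entryP _ _) _.
apply: etrans (congr2 (fun x y => x * a + y) (shadowE X) (shadowE Y)) _.
apply: etrans (congr1 (+%R^~ _) (esym (complex_expectMr mu a bX))) _.
apply: etrans (esym (complex_expectD mu bXa bY)) _.
congr complex_expect; apply/funext => t; apply: etrans (esym (entryP _ _)) _.
by rewrite /shadow_integrand !linearP.
Qed.

Variable Minv : 'M[R[i]]_N -> 'M[R[i]]_N.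
Hypothesis hMinvl : cancel (shadow_map mu U) Minv.
Hypothesis hMinvr : cancel Minv (shadow_map mu U).

(** Linearity passes to the inverse: both sides have the same image under [shadow_map]. *)
Lemma inverse_shadow_map_is_linear : linear Minv.
Proof. by move=> a X Y; apply: (canLR hMinvl); rewrite shadow_map_is_linear !hMinvr. Qed.

End ShadowMap.

(** Jensen for the square: the weighted variance about the weighted mean is nonnegative. *)
Lemma sqr_weighted_sum_le (R : realFieldType) (J : finType) (w x : J -> R) :
  (forall j, 0 <= w j) -> \sum_j w j = 1 ->
  (\sum_j w j * x j) ^+ 2 <= \sum_j w j * x j ^+ 2.
Proof.
move=> w0 w1.
have expand c : \sum_j w j * (x j - c) ^+ 2 =
    \sum_j w j * x j ^+ 2 - 2 * c * (\sum_j w j * x j) + c ^+ 2 * \sum_j w j.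
  by rewrite !mulr_sumr -sumrB -big_split; apply: eq_bigr => j _ /=; ring.
have : 0 <= \sum_j w j * (x j - \sum_j w j * x j) ^+ 2.
  by apply: sumr_ge0 => j _; rewrite mulr_ge0// sqr_ge0.
rewrite expand w1; lra.
Qed.

Lemma weight_le1 (R : realFieldType) (J : finType) (w : J -> R) j :
  (forall j, 0 <= w j) -> \sum_j w j = 1 -> w j <= 1.
Proof. by move=> w0 <-; rewrite (bigD1 j)//= lerDl sumr_ge0. Qed.

Lemma bounded_measurable_weight (R : realType) (d : measure_display)
    (T : measurableType d) (J : finType) (w : T -> J -> R) j :
  (forall j, measurable_fun setT (w ^~ j)) ->
  (forall t j, 0 <= w t j) -> (forall t, \sum_j w t j = 1) ->
  bounded_measurable (w ^~ j).
Proof.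
move=> mw w0 w1; split=> //; exists 1 => t.
by rewrite ger0_norm// weight_le1.
Qed.

(* Includes the zeros of f, where (f t)^-1 = 0. *)
Lemma measurable_fun_inv_ge0 (R : realType) (d : measure_display)
    (T : measurableType d) (f : T -> R) :
  (forall t, 0 <= f t) -> measurable_fun setT f ->
  measurable_fun setT (fun t => (f t)^-1).
Proof.
move=> f0 mf; under eq_fun do rewrite -powR_inv1//.
exact: measurableT_comp (measurable_powR _) mf.
Qed.

(** The norms are suprema of square roots. The uniform bound [c] is essential: without an upper
    bound, [sup] is a default value that dominates nothing. *)
Lemma le_sqr_sup_sqrt (R : realType) (X : Type) (D : set X) (f : X -> R) (c : R) x :
  D x -> (forall y, D y -> 0 <= f y <= c) ->
  f x <= sup [set Num.sqrt (f y) | y in D] ^+ 2.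
Proof.
move=> Dx fc; have /andP[f0 _] := fc _ Dx.
have sS : Num.sqrt (f x) <= sup [set Num.sqrt (f y) | y in D].
  apply: ub_le_sup; last by exists x.
  exists (Num.sqrt c) => _ [y Dy <-]; rewrite ler_wsqrtr//.
  by have /andP[] := fc _ Dy.
rewrite -{1}(sqr_sqrtr f0) lerXn2r// nnegrE; first exact: sqrtr_ge0.
exact: le_trans (sqrtr_ge0 _) sS.
Qed.

(** * The noisy estimator *)

(** The factors on the right are in the order used by [norm_XS]. *)
Lemma sqr_sum_mul (R : comPzRingType) (J : finType) (w x : J -> R) :
  (\sum_j w j * x j) ^+ 2 = \sum_j \sum_j' x j * x j' * w j * w j'.
Proof.
rewrite expr2 mulr_suml; apply: eq_bigr => j _.
by rewrite mulr_sumr; apply: eq_bigr => j' _; ring.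
Qed.

(** Makes the noiseless outcome law a special case of the noisy one. *)
Lemma quantum_channel_id (R : realType) (N : nat) :
  quantum_channel (id : 'M[R[i]]_N -> 'M[R[i]]_N).
Proof. by split=> // k X Xpsd; rewrite /ampliation submxblockK. Qed.

Section ShotProbability.
Context {R : realType} {N : nat} {T : Type}.
Variables (U : T -> 'M[R[i]]_N) (E : T -> 'M[R[i]]_N -> 'M[R[i]]_N) (rho : 'M[R[i]]_N).
Hypothesis hU : forall t, U t \is unitarymx.
Hypothesis hE : forall t, quantum_channel (E t).
Hypothesis hrho : density rho.

Lemma channel_diag_ge0 t b : 0 <= E t (uchan (U t) rho) b b.
Proof.
apply: psd_diag_ge0; apply: completely_positive_psd; first by case: (hE t).
by apply: psd_uchan; case: hrho.
Qed.

(** The diagonal of a positive semidefinite matrix is real, so the real part in [shot_prob] discards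
    nothing. *)
Lemma shot_prob_complex t b :
  (shot_prob U E rho t b)%:C = E t (uchan (U t) rho) b b.
Proof.
by rewrite /shot_prob hsdot_ketbra RRe_real// ger0_real// channel_diag_ge0.
Qed.

Lemma shot_prob_ge0 t b : 0 <= shot_prob U E rho t b.
Proof. by rewrite -ler0c shot_prob_complex channel_diag_ge0. Qed.

Lemma sum_shot_prob t : \sum_b shot_prob U E rho t b = 1.
Proof.
apply: complexI; rewrite rmorph_sum rmorph1 -(proj2 hrho).
rewrite -(mxtrace_uchan rho (hU t)) -(proj2 (hE t)).
by apply: eq_bigr => b _; exact: shot_prob_complex.
Qed.

(** The measured state is a mixture of basis states with real weights, which can be pulled out of
    [complex.Re]. *)
Lemma meas_channel_shot_prob t :
  meas_channel (E t (uchan (U t) rho)) = \sum_b (shot_prob U E rho t b)%:C *: ketbra R b.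
Proof. by apply: eq_bigr => b _; rewrite hsdot_ketbra shot_prob_complex. Qed.

End ShotProbability.

Section InstanceProbability.
Context {R : realType} {T : Type} {I : finType} (Q : T -> I -> R).

Lemma gamma'_ge0 t : 0 <= gamma' Q t.
Proof. by apply: sumr_ge0 => B _. Qed.

Lemma inst_prob_ge0 t B : 0 <= inst_prob Q t B.
Proof. by rewrite divr_ge0// gamma'_ge0. Qed.

Lemma sum_inst_prob t : gamma' Q t != 0 -> \sum_B inst_prob Q t B = 1.
Proof. by move=> g0; rewrite -mulr_suml divff. Qed.

(** The importance-sampling identity: probability times weight is the quasiprobability. At
    [Q t B = 0] both sides vanish, as division by zero yields 0. *)
Lemma inst_prob_coeff t B : gamma' Q t != 0 ->
  inst_prob Q t B * (gamma' Q t * inst_sgn Q t B) = Q t B.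
Proof.
move=> g0; rewrite /inst_prob /inst_sgn mulrA divfK//.
have [->|Q0] := eqVneq (Q t B) 0; first by rewrite mul0r mulr0.
by rewrite mulrC divfK// normr_eq0.
Qed.

(** Not an equality: the sign is 0 where the coefficient vanishes. *)
Lemma inst_sgn_sqr_le1 t B : inst_sgn Q t B ^+ 2 <= 1.
Proof.
rewrite /inst_sgn expr_div_n real_normK ?num_real//.
have [->|Q0] := eqVneq (Q t B) 0; first by rewrite expr0n mul0r.
by rewrite divff// expf_neq0.
Qed.

End InstanceProbability.

Lemma bounded_measurable_inst_sgn (R : realType) (d : measure_display)
    (T : measurableType d) (I : finType) (Q : T -> I -> R) B :
  measurable_fun setT (Q ^~ B) -> bounded_measurable (inst_sgn Q ^~ B).
Proof.
move=> mQ; split.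
  apply: measurable_funM => //; apply: measurable_fun_inv_ge0 => //.
  exact: measurableT_comp.
by exists 1 => t; rewrite -(@expr_le1 _ 2)// real_normK ?num_real// inst_sgn_sqr_le1.
Qed.

Lemma Re_linear_real_combination (R : realType) (N : nat)
    (f : {linear 'M[R[i]]_N -> R[i] | *%R}) (J : finType) (c : J -> R)
    (X : J -> 'M[R[i]]_N) :
  complex.Re (f (\sum_j (c j)%:C *: X j)) = \sum_j c j * complex.Re (f (X j)).
Proof.
rewrite linear_sum Re_sum; apply: eq_bigr => j _.
by rewrite linearZ Re_realM.
Qed.

(** * Mean and variance of the noisy estimator *)

Section NoisyShadow.
Context {R : realType} {N : nat} {d : measure_display} {T : measurableType d}.
Local Notation C := R[i].
Variables (mu : probability T R) (U : T -> 'M[C]_N).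
Hypothesis N_gt0 : (0 < N)%N.
Hypothesis hU : forall t, U t \is unitarymx.
Hypothesis hUmeas : measurable_superop (fun t => uchan (U t)).
Variable Minv : 'M[C]_N -> 'M[C]_N.
Hypothesis hMinvl : cancel (shadow_map mu U) Minv.
Hypothesis hMinvr : cancel Minv (shadow_map mu U).
Variables (E E' : T -> {linear 'M[C]_N -> 'M[C]_N}) (E'inv : T -> 'M[C]_N -> 'M[C]_N).
Hypothesis hE : forall t, quantum_channel (E t).
Hypothesis hEmeas : measurable_superop (fun t => E t).
Hypothesis hE'l : forall t, cancel (E' t) (E'inv t).
Hypothesis hE'r : forall t, cancel (E'inv t) (E' t).
Hypothesis hE' : forall t X, E' t (meas_channel X) = meas_channel (E t X).
Variables (I : finType) (op : I -> {linear 'M[C]_N -> 'M[C]_N}) (Q : T -> I -> R).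
Hypothesis hQmeas : forall B, measurable_fun setT (fun t => Q t B).
Hypothesis hQ : forall t X, E'inv t X = \sum_(B : I) (Q t B)%:C *: op B X.
Hypothesis hgamma : has_ubound (range (gamma' Q)).
Variable O : 'M[C]_N.
Hypothesis hO : O \is hermsymmx.

Let ringB := @bounded_measurable_function_ring R d T.
Let ringM := @measurable_function_ring R d T.
Let bUd := bounded_uchan_delta hU hUmeas.

(** If all coefficients vanished, the inverse of [E' t] would be 0, which is impossible on a nonzero
    matrix space; hence [N_gt0]. *)
Lemma gamma'_gt0 t : 0 < gamma' Q t.
Proof.
rewrite lt_neqAle gamma'_ge0 andbT eq_sym; apply/negP => /eqP g0.
have Q0 B : Q t B = 0.
  apply/eqP; rewrite -normr_le0 -g0 /gamma' (bigD1 B)//= lerDl.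
  exact: sumr_ge0.
have inv0 X : E'inv t X = 0.
  by rewrite hQ big1// => B _; rewrite Q0 scale0r.
have := hE'r t (ketbra R (Ordinal N_gt0)); rewrite inv0 linear0.
move=> /matrixP/(_ (Ordinal N_gt0) (Ordinal N_gt0)) /eqP.
by rewrite /ketbra !mxE !eqxx eq_sym oner_eq0.
Qed.

Let gamma_neq0 t : gamma' Q t != 0.
Proof. by rewrite gt_eqF// gamma'_gt0. Qed.

Definition inverse_shadow_form (X : 'M[C]_N) : C := hsdot O (Minv X).

Lemma inverse_shadow_form_is_linear : linear_for *%R inverse_shadow_form.
Proof.
move=> a X Y; rewrite /inverse_shadow_form.
by rewrite (inverse_shadow_map_is_linear hU hUmeas hMinvl hMinvr) linearP.
Qed.

Let L : {linear 'M[C]_N -> C | *%R} := HB.pack inverse_shadow_form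
  (GRing.isLinear.Build C _ _ _ inverse_shadow_form inverse_shadow_form_is_linear).

Lemma Re_form_real_combination (J : finType) V (c : J -> R) (X : J -> 'M[C]_N) :
  complex.Re (inverse_shadow_form (uchan_dag V (\sum_j (c j)%:C *: X j))) =
  \sum_j c j * complex.Re (inverse_shadow_form (uchan_dag V (X j))).
Proof.
have -> : uchan_dag V (\sum_j (c j)%:C *: X j) = \sum_j (c j)%:C *: uchan_dag V (X j).
  by rewrite linear_sum; apply: eq_bigr => j _; rewrite linearZ.
exact: (Re_linear_real_combination L).
Qed.

Lemma bounded_shadow_bracket Phi b :
  bounded_measurable (fun t => shadow_bracket U Minv O Phi t b).
Proof.
suff [] : componentwise (@bounded_measurable R d T)
    (fun t => L (uchan_dag (U t) (Phi (ketbra R b)))) by [].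
apply: componentwise_linear_form => // i j.
by apply: componentwise_uchan_dag => // k l; exact: componentwise_cst.
Qed.

(* The ideal signal <<O| M^-1 U^dagger M_Z U |rho>>, which is the conditional
   mean of the noisy estimator given the circuit. *)
Definition signal rho t : R := complex.Re (inverse_shadow_form (shadow_integrand U rho t)).

Lemma bounded_signal rho : bounded_measurable (signal rho).
Proof.
suff [] : componentwise (@bounded_measurable R d T)
    (fun t => L (shadow_integrand U rho t)) by [].
by apply: componentwise_linear_form => // i j; exact: bounded_shadow_integrand.
Qed.

(** The linear form commutes with the expectation, and [Minv] then cancels the shadow map.
    Hermiticity of [O] removes the adjoint in [hsdot]. *)
Lemma integral_signal rho : \int[mu]_t signal rho t = complex.Re (\tr (O *m rho)).
Proof.
have OE : O = O^t*.
  by have /is_hermitianmxP := hO; rewrite expr0 scale1r.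
have Lexpect : inverse_shadow_form (shadow_map mu U rho) =
    complex_expect mu (fun t => inverse_shadow_form (shadow_integrand U rho t)).
  exact: (linear_form_expect_mx mu L (bounded_shadow_integrand hU hUmeas rho)).
rewrite [in RHS]OE -[\tr _]/(hsdot O rho) -[in RHS](hMinvl rho).
by rewrite -[hsdot _ _]/(inverse_shadow_form _) Lexpect.
Qed.

Lemma signal_ideal rho t : density rho ->
  signal rho t = \sum_b shot_prob U (fun=> id) rho t b * shadow_bracket U Minv O id t b.
Proof.
move=> hrho; rewrite /signal /shadow_integrand.
have -> := @meas_channel_shot_prob _ _ _ U (fun=> id) rho (fun=> quantum_channel_id R N) hrho t.
exact: Re_form_real_combination.
Qed.

Lemma signal_noisy rho t : density rho ->
  signal rho t = \sum_b shot_prob U (fun t => E t) rho t b *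
    \sum_B inst_prob Q t B * estimator U Minv (fun B => op B) Q O t b B.
Proof.
move=> hrho; rewrite /signal /shadow_integrand.
(* The identity is inserted before the measurement as [E'inv t] after [E' t]; [hE'] trades [E' t]
   for the physical noise, and [hQ] expands the inverse. *)
rewrite -(hE'l t (meas_channel _)) hE' hQ.
have -> := @meas_channel_shot_prob _ _ _ U (fun t => E t) rho hE hrho t.
rewrite Re_form_real_combination.
rewrite (eq_bigr (fun B => \sum_b shot_prob U (fun t => E t) rho t b *
   (inst_prob Q t B * estimator U Minv (fun B => op B) Q O t b B))) => [|B _].
  by rewrite exchange_big; apply: eq_bigr => b _; rewrite mulr_sumr.
have -> : op B (\sum_b (shot_prob U (fun t => E t) rho t b)%:C *: ketbra R b) =
    \sum_b (shot_prob U (fun t => E t) rho t b)%:C *: op B (ketbra R b).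
  by rewrite linear_sum; apply: eq_bigr => b _; rewrite linearZ.
rewrite Re_form_real_combination mulr_sumr; apply: eq_bigr => b _.
by rewrite /estimator [inst_prob _ _ _ * _]mulrA inst_prob_coeff// mulrCA.
Qed.

Lemma bounded_gamma' : bounded_measurable (gamma' Q).
Proof.
split.
  apply: (function_ring_sum ringM) => B; exact: measurableT_comp.
have [c hc] := hgamma; exists c => t.
by rewrite ger0_norm ?gamma'_ge0//; apply: hc; exists t.
Qed.

Lemma gamma'_le_max t : gamma' Q t <= gamma'_max Q.
Proof. by apply: ub_le_sup => //; exists t. Qed.

Lemma bounded_inst_prob B : bounded_measurable (inst_prob Q ^~ B).
Proof.
apply: bounded_measurable_weight => [{}B|t {}B|t].
- apply: measurable_funM; first exact: measurableT_comp.
  by apply: measurable_fun_inv_ge0; [exact: gamma'_ge0|case: bounded_gamma'].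
- exact: inst_prob_ge0.
- exact: sum_inst_prob.
Qed.

Lemma bounded_estimator b B :
  bounded_measurable (fun t => estimator U Minv (fun B => op B) Q O t b B).
Proof.
apply: bounded_measurableM; last exact: bounded_shadow_bracket.
by apply: bounded_measurableM; [exact: bounded_gamma'|exact: bounded_measurable_inst_sgn].
Qed.

Lemma bounded_shot_prob rho b : density rho ->
  bounded_measurable (shot_prob U (fun t => E t) rho ^~ b).
Proof.
move=> hrho; apply: bounded_measurable_weight => [{}b|t {}b|t].
(* Only measurability is needed from the noise: the bound holds because these are probabilities. *)
- suff [] : componentwise (fun f : T -> R => measurable_fun setT f)
      (fun t => E t (uchan (U t) rho) b b).
    by move=> mR _; apply: eq_measurable_fun mR => t _; rewrite /shot_prob hsdot_ketbra.
  apply: componentwise_linear => // [k l|i j].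
    by have [mR mI] := hEmeas (delta_mx k l) b b.
  have bU := componentwise_uchan ringB bUd rho i j.
  by case: bU => [[mR _] [mI _]].
- exact: shot_prob_ge0.
- exact: sum_shot_prob.
Qed.

Let p rho := shot_prob U (fun t => E t) rho.
Let f t b B := shadow_bracket U Minv O (op B) t b.

Definition ns1_integrand rho t : R :=
  \sum_(b < N) p rho t b * (\sum_(B : I) inst_prob Q t B * f t b B ^+ 2).

Definition ns2_integrand rho t : R :=
  \sum_(b < N) p rho t b *
    (\sum_(B : I) inst_prob Q t B * inst_sgn Q t B * f t b B) ^+ 2.

Lemma bounded_ns1_integrand rho : density rho -> bounded_measurable (ns1_integrand rho).
Proof.
move=> hrho; apply: bounded_measurable_sum => b; apply: bounded_measurableM.
  exact: bounded_shot_prob.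
apply: bounded_measurable_sum => B; apply: bounded_measurableM.
  exact: bounded_inst_prob.
by apply: bounded_measurableX; exact: bounded_shadow_bracket.
Qed.

Lemma bounded_ns2_integrand rho : density rho -> bounded_measurable (ns2_integrand rho).
Proof.
move=> hrho; apply: bounded_measurable_sum => b; apply: bounded_measurableM.
  exact: bounded_shot_prob.
apply: bounded_measurableX; apply: bounded_measurable_sum => B.
apply: bounded_measurableM; last exact: bounded_shadow_bracket.
by apply: bounded_measurableM; [exact: bounded_inst_prob|exact: bounded_measurable_inst_sgn].
Qed.

Lemma ns2_integrand_ge0 rho t : density rho -> 0 <= ns2_integrand rho t.
Proof.
move=> hrho; apply: sumr_ge0 => b _; apply: mulr_ge0; first exact: shot_prob_ge0.
exact: sqr_ge0.
Qed.

(** Jensen for the law of the instance, applied to the signed brackets; squaring removes the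
    signs. *)
Lemma ns2_le_ns1_integrand rho t : density rho ->
  ns2_integrand rho t <= ns1_integrand rho t.
Proof.
move=> hrho; apply: ler_sum => b _; apply: ler_wpM2l; first exact: shot_prob_ge0.
under eq_bigr do rewrite -mulrA.
apply: le_trans (sqr_weighted_sum_le _ _ _) _.
- by move=> B; exact: inst_prob_ge0.
- exact: sum_inst_prob.
apply: ler_sum => B _; apply: ler_wpM2l; first exact: inst_prob_ge0.
by rewrite exprMn ler_piMl ?sqr_ge0// inst_sgn_sqr_le1.
Qed.

(** Replacing every probability by 1 gives a bound [H] independent of the state. It makes the
    suprema defining both noisy norms finite. *)
Lemma ns1_integral_bounded : exists c, forall rho, density rho ->
  \int[mu]_t ns1_integrand rho t <= c.
Proof.
pose H t := \sum_(b < N) \sum_(B : I) f t b B ^+ 2.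
have bH : bounded_measurable H.
  do 2![apply: bounded_measurable_sum => ?].
  by apply: bounded_measurableX; exact: bounded_shadow_bracket.
exists (\int[mu]_t H t) => rho hrho; apply: prob_le_Rintegral => //.
  exact: bounded_ns1_integrand.
move=> t; apply: ler_sum => b _.
apply: (@le_trans _ _ (\sum_B inst_prob Q t B * f t b B ^+ 2)).
  rewrite ler_piMl//.
    by apply: sumr_ge0 => B _; rewrite mulr_ge0 ?inst_prob_ge0 ?sqr_ge0.
  apply: (weight_le1 (w := p rho t)) => [b'|]; [exact: shot_prob_ge0|exact: sum_shot_prob].
apply: ler_sum => B _; rewrite ler_piMl ?sqr_ge0//.
by apply: (weight_le1 (w := inst_prob Q t)) => [B'|]; [exact: inst_prob_ge0|exact: sum_inst_prob].
Qed.

(** Jensen for the ideal outcome law, after which the probabilities are bounded by 1; this makes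
    [norm_XS] finite. *)
Lemma signal_sqr_integral_bounded : exists c, forall rho, density rho ->
  \int[mu]_t signal rho t ^+ 2 <= c.
Proof.
pose H t := \sum_(b < N) shadow_bracket U Minv O id t b ^+ 2.
have bH : bounded_measurable H.
  apply: bounded_measurable_sum => b.
  by apply: bounded_measurableX; exact: bounded_shadow_bracket.
exists (\int[mu]_t H t) => rho hrho; apply: prob_le_Rintegral => //.
  by apply: bounded_measurableX; exact: bounded_signal.
have id_channel (t : T) := quantum_channel_id R N.
have p0 t b : 0 <= shot_prob U (fun=> id) rho t b.
  exact: (@shot_prob_ge0 _ _ _ U (fun=> id) rho id_channel hrho).
have p1 t : \sum_b shot_prob U (fun=> id) rho t b = 1.
  exact: (@sum_shot_prob _ _ _ U (fun=> id) rho hU id_channel hrho).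
move=> t; rewrite signal_ideal//; apply: le_trans (sqr_weighted_sum_le _ (p0 t) (p1 t)) _.
apply: ler_sum => b _; rewrite ler_piMl ?sqr_ge0//.
exact: (weight_le1 b (p0 t) (p1 t)).
Qed.

Let NS1 := norm_NS1 mu U (fun t => E t) Minv (fun B => op B) Q O.
Let NS2 := norm_NS2 mu U (fun t => E t) Minv (fun B => op B) Q O.

Lemma ns1_integrand_ge0 rho t : density rho -> 0 <= ns1_integrand rho t.
Proof.
by move=> hrho; exact: le_trans (ns2_integrand_ge0 t hrho) (ns2_le_ns1_integrand t hrho).
Qed.

Lemma ns2_integral_le_ns1 rho : density rho ->
  \int[mu]_t ns2_integrand rho t <= \int[mu]_t ns1_integrand rho t.
Proof.
move=> hrho; apply: prob_le_Rintegral; first exact: bounded_ns2_integrand.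
  exact: bounded_ns1_integrand.
by move=> t; exact: ns2_le_ns1_integrand.
Qed.

Lemma ns1_integral_le_norm rho : density rho ->
  \int[mu]_t ns1_integrand rho t <= NS1 ^+ 2.
Proof.
move=> hrho; have [c hc] := ns1_integral_bounded.
apply: (@le_sqr_sup_sqrt _ _ (@density R N) (fun r => \int[mu]_t ns1_integrand r t) c) => //.
by move=> r hr; rewrite hc// andbT; apply: Rintegral_ge0 => t _; exact: ns1_integrand_ge0.
Qed.

Lemma ns2_integral_le_norm rho : density rho ->
  \int[mu]_t ns2_integrand rho t <= NS2 ^+ 2.
Proof.
move=> hrho; have [c hc] := ns1_integral_bounded.
apply: (@le_sqr_sup_sqrt _ _ (@density R N) (fun r => \int[mu]_t ns2_integrand r t) c) => //.
move=> r hr; rewrite (le_trans (ns2_integral_le_ns1 hr) (hc _ hr)) andbT.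
by apply: Rintegral_ge0 => t _; exact: ns2_integrand_ge0.
Qed.

(** The double sum over outcomes in [norm_XS] factors as the square of the ideal signal. *)
Lemma signal_sqr_integral_le_norm rho : density rho ->
  \int[mu]_t signal rho t ^+ 2 <= norm_XS mu U Minv O ^+ 2.
Proof.
move=> hrho; have [c hc] := signal_sqr_integral_bounded.
have -> : norm_XS mu U Minv O =
    sup [set Num.sqrt (\int[mu]_t signal r t ^+ 2) | r in @density R N].
  congr sup; apply: eq_imagel => r hr; congr Num.sqrt.
  apply: eq_Rintegral => t _; rewrite signal_ideal//.
  exact: (esym (sqr_sum_mul _ _)).
apply: (@le_sqr_sup_sqrt _ _ (@density R N) (fun r => \int[mu]_t signal r t ^+ 2) c) => //.
by move=> r hr; rewrite hc// andbT; apply: Rintegral_ge0 => t _; exact: sqr_ge0.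
Qed.

Lemma norm_NS2_le_NS1 : NS2 <= NS1.
Proof.
apply: ge_sup.
  (* [ge_sup] asks for a nonempty set; a basis state supplies an element. *)
  by exists (Num.sqrt (\int[mu]_t ns2_integrand (ketbra R (Ordinal N_gt0)) t));
    exists (ketbra R (Ordinal N_gt0)) => //; exact: density_ketbra.
move=> _ [rho hrho <-].
apply: (@le_trans _ _ (Num.sqrt (\int[mu]_t ns1_integrand rho t))).
  by apply: ler_wsqrtr; exact: ns2_integral_le_ns1.
apply: ub_le_sup; last by exists rho.
have [c hc] := ns1_integral_bounded.
by exists (Num.sqrt c) => _ [r hr <-]; apply: ler_wsqrtr; exact: hc.
Qed.

Let gamma'_sqr_le_max t : gamma' Q t ^+ 2 <= gamma'_max Q ^+ 2.
Proof.
have g0 := gamma'_ge0 Q t; have gm := gamma'_le_max t.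
by rewrite lerXn2r// nnegrE (le_trans g0).
Qed.

Lemma estimator_second_moment rho t : density rho ->
  \sum_b p rho t b * (\sum_B inst_prob Q t B *
     estimator U Minv (fun B => op B) Q O t b B ^+ 2) <=
  gamma'_max Q ^+ 2 * ns1_integrand rho t.
Proof.
move=> hrho.
apply: (@le_trans _ _ (gamma' Q t ^+ 2 * ns1_integrand rho t)); last first.
  by apply: ler_wpM2r => //; exact: ns1_integrand_ge0.
rewrite mulr_sumr; apply: ler_sum => b _; rewrite [leRHS]mulrCA.
apply: ler_wpM2l; first exact: shot_prob_ge0.
rewrite mulr_sumr; apply: ler_sum => B _; rewrite [leRHS]mulrCA.
apply: ler_wpM2l; first exact: inst_prob_ge0.
rewrite /estimator 2!exprMn -mulrA; apply: ler_wpM2l; first exact: sqr_ge0.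
by rewrite ler_piMl ?sqr_ge0// inst_sgn_sqr_le1.
Qed.

Lemma estimator_mixed_moment rho t : density rho ->
  \sum_b p rho t b * (\sum_B inst_prob Q t B *
     estimator U Minv (fun B => op B) Q O t b B) ^+ 2 <=
  gamma'_max Q ^+ 2 * ns2_integrand rho t.
Proof.
move=> hrho.
apply: (@le_trans _ _ (gamma' Q t ^+ 2 * ns2_integrand rho t)); last first.
  by apply: ler_wpM2r => //; exact: ns2_integrand_ge0.
(* Equality holds here: [gamma' Q t] does not depend on the instance, and the signs stay inside the
   square. *)
rewrite le_eqVlt; apply/orP; left; apply/eqP.
rewrite mulr_sumr; apply: eq_bigr => b _; rewrite [RHS]mulrCA -exprMn; congr (_ * _ ^+ 2).
by rewrite mulr_sumr; apply: eq_bigr => B _; rewrite /estimator /f; ring.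
Qed.

Lemma noisy_shadow_unbiased rho : density rho ->
  forall (d' : measure_display) (W : measurableType d') (P : probability W R)
     (Uw : W -> T) (bw : W -> 'I_N) (Bw : W -> I),
  single_draw mu (p rho) (inst_prob Q) P Uw bw Bw ->
  'E_P[fun w => estimator U Minv (fun B => op B) Q O (Uw w) (bw w) (Bw w)]%E
  = (complex.Re (\tr (O *m rho)))%:E.
Proof.
move=> hrho d' W P Uw bw Bw draw.
have bp b : bounded_measurable (p rho ^~ b) by exact: bounded_shot_prob.
have p1 t : \sum_b p rho t b = 1 by exact: sum_shot_prob.
have q1 t : \sum_B inst_prob Q t B = 1 by exact: sum_inst_prob.
rewrite (expect_single_draw bp bounded_inst_prob p1 q1 bounded_estimator draw).
rewrite -integral_signal; congr EFin; apply: eq_Rintegral => t _.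
by rewrite (signal_noisy t hrho).
Qed.

Lemma noisy_shadow_variance rho (M K L' : nat) : density rho ->
  (0 < M)%N -> (0 < K)%N -> (0 < L')%N ->
  forall (d' : measure_display) (W : measurableType d') (P : probability W R)
     (Uw : 'I_M -> W -> T) (bw : 'I_M -> 'I_K -> W -> 'I_N)
     (Bw : 'I_M -> 'I_K -> 'I_L' -> W -> I),
  mkl_scheme mu (p rho) (inst_prob Q) P Uw bw Bw ->
  ('V_P[(fun w => (\sum_(m < M) \sum_(k < K) \sum_(l < L')
         estimator U Minv (fun B => op B) Q O (Uw m w) (bw m k w)
           (Bw m k l w)) / (M * K * L')%:R)%R]
     <= (M%:R^-1 * (gamma'_max Q ^+ 2 / K%:R *
           (L'%:R^-1 * NS1 ^+ 2 + (1 - L'%:R^-1) * NS2 ^+ 2) +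
         (1 - K%:R^-1) * norm_XS mu U Minv O ^+ 2))%R%:E)%E.
Proof.
move=> hrho M0 K0 L0 d' W P Uw bw Bw scheme.
have bp b : bounded_measurable (p rho ^~ b) by exact: bounded_shot_prob.
have p0 t b : 0 <= p rho t b by exact: shot_prob_ge0.
have p1 t : \sum_b p rho t b = 1 by exact: sum_shot_prob.
have q1 t : \sum_B inst_prob Q t B = 1 by exact: sum_inst_prob.
apply: le_trans (variance_mkl_scheme bp bounded_inst_prob p0 (inst_prob_ge0 Q) p1 q1
  bounded_estimator M0 K0 L0 scheme) _.
have invn_ge0 (k : nat) : 0 <= (k%:R : R)^-1 by rewrite invr_ge0 ler0n.
(* Nonnegative coefficients allow the three moments to be bounded separately. *)
have invn_le1 (k : nat) : (0 < k)%N -> 0 <= 1 - (k%:R : R)^-1.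
  by move=> k0; rewrite subr_ge0 invf_le1 ?ltr0n// ler1n.
rewrite lee_fin; apply: ler_wpM2l => //.
set g2 := gamma'_max Q ^+ 2.
have bcM c (h : T -> R) : bounded_measurable h -> bounded_measurable (fun t => c * h t).
  by move=> bh; apply: bounded_measurableM => //; exact: bounded_measurable_cst.
have b1 := bounded_ns1_integrand hrho; have b2 := bounded_ns2_integrand hrho.
have bs : bounded_measurable (fun t => signal rho t ^+ 2).
  by apply: bounded_measurableX; exact: bounded_signal.
(* First the moments are compared circuit by circuit for the given state; only after integration is
   each term bounded by its own supremum over states. *)
apply: (@le_trans _ _ (\int[mu]_t ((g2 / K%:R) * (L'%:R^-1 * ns1_integrand rho t +
    (1 - L'%:R^-1) * ns2_integrand rho t) + (1 - K%:R^-1) * signal rho t ^+ 2))).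
  apply: prob_le_Rintegral.
  - apply: bounded_measurableD; apply: (bcM).
      apply: bounded_measurableD; apply: (bcM); apply: bounded_measurable_sum => b;
        apply: bounded_measurableM => //.
        apply: bounded_measurable_sum => B; apply: bounded_measurableM.
          exact: bounded_inst_prob.
        by apply: bounded_measurableX; exact: bounded_estimator.
      apply: bounded_measurableX; apply: bounded_measurable_sum => B.
      by apply: bounded_measurableM; [exact: bounded_inst_prob|exact: bounded_estimator].
    apply: bounded_measurableX; apply: bounded_measurable_sum => b.
    apply: bounded_measurableM => //; apply: bounded_measurable_sum => B.
    by apply: bounded_measurableM; [exact: bounded_inst_prob|exact: bounded_estimator].
  - by apply: bounded_measurableD; apply: (bcM) => //; apply: bounded_measurableD; exact: bcM.
  (* The term of distinct shots equals the square of the signal exactly, so no factor [gamma'_max]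
     enters it. *)
  - move=> t; rewrite (signal_noisy t hrho); apply: lerD => //.
    rewrite [g2 / _]mulrC -mulrA; apply: ler_wpM2l => //.
    rewrite mulrDr ![g2 * (_ * _)]mulrCA; apply: lerD; apply: ler_wpM2l.
    + by [].
    + exact: estimator_second_moment.
    + exact: invn_le1.
    + exact: estimator_mixed_moment.
rewrite prob_RintegralD; [|by apply: (bcM); apply: bounded_measurableD; exact: bcM|exact: bcM].
rewrite prob_RintegralZl; last by apply: bounded_measurableD; exact: bcM.
rewrite prob_RintegralD; [|exact: bcM..].
rewrite !prob_RintegralZl//.
have g20 : 0 <= g2 / K%:R by rewrite mulr_ge0// sqr_ge0.
apply: lerD; apply: ler_wpM2l.
- by [].
- apply: lerD; apply: ler_wpM2l.
  + by [].
  + exact: ns1_integral_le_norm.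
  + exact: invn_le1.
  + exact: ns2_integral_le_norm.
- exact: invn_le1.
- exact: signal_sqr_integral_le_norm.
Qed.

End NoisyShadow.

Theorem theorem3 (R : realType) (n : nat)
  (d : measure_display) (T : measurableType d) (mu : probability T R)
  (U : T -> 'M[R[i]]_(2 ^ n))
  (hU : forall t, U t \is unitarymx)
  (hUmeas : measurable_superop (fun t => uchan (U t)))
  (Minv : 'M[R[i]]_(2 ^ n) -> 'M[R[i]]_(2 ^ n))
  (hMinvl : cancel (shadow_map mu U) Minv)
  (hMinvr : cancel Minv (shadow_map mu U))
  (E : T -> {linear 'M[R[i]]_(2 ^ n) -> 'M[R[i]]_(2 ^ n)})
  (hE : forall t, quantum_channel (E t))
  (hEmeas : measurable_superop (fun t => E t))
  (E' : T -> {linear 'M[R[i]]_(2 ^ n) -> 'M[R[i]]_(2 ^ n)})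
  (E'inv : T -> 'M[R[i]]_(2 ^ n) -> 'M[R[i]]_(2 ^ n))
  (hE'l : forall t, cancel (E' t) (E'inv t))
  (hE'r : forall t, cancel (E'inv t) (E' t))
  (hE' : forall t X, E' t (meas_channel X) = meas_channel (E t X))
  (I : finType)
  (op : I -> {linear 'M[R[i]]_(2 ^ n) -> 'M[R[i]]_(2 ^ n)})
  (hop : forall B, completely_positive (op B) /\ trace_nonincreasing (op B))
  (Q : T -> I -> R)
  (hQmeas : forall B, measurable_fun setT (fun t => Q t B))
  (hQ : forall t X, E'inv t X = \sum_(B : I) (Q t B)%:C *: op B X)
  (hgamma : has_ubound (range (gamma' Q)))
  (O : 'M[R[i]]_(2 ^ n)) (hO : O \is hermsymmx) :
  (forall (rho : 'M[R[i]]_(2 ^ n)) (hrho : density rho)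
     (d' : measure_display) (W : measurableType d') (P : probability W R)
     (Uw : W -> T) (bw : W -> 'I_(2 ^ n)) (Bw : W -> I),
     single_draw mu (shot_prob U (fun t => E t) rho) (inst_prob Q)
       P Uw bw Bw ->
     'E_P[fun w => estimator U Minv (fun B => op B) Q O (Uw w) (bw w) (Bw w)]%E
     = (complex.Re (\tr (O *m rho)))%:E) /\
  (forall (rho : 'M[R[i]]_(2 ^ n)) (hrho : density rho)
     (M K L : nat) (hM : (0 < M)%N) (hK : (0 < K)%N) (hL : (0 < L)%N)
     (d' : measure_display) (W : measurableType d') (P : probability W R)
     (Uw : 'I_M -> W -> T) (bw : 'I_M -> 'I_K -> W -> 'I_(2 ^ n))
     (Bw : 'I_M -> 'I_K -> 'I_L -> W -> I),
     mkl_scheme mu (shot_prob U (fun t => E t) rho) (inst_prob Q)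
       P Uw bw Bw ->
     ('V_P[(fun w => (\sum_(m < M) \sum_(k < K) \sum_(l < L)
         estimator U Minv (fun B => op B) Q O (Uw m w) (bw m k w)
           (Bw m k l w)) / (M * K * L)%:R)%R]
     <= (M%:R^-1 * (gamma'_max Q ^+ 2 / K%:R *
           (L%:R^-1 *
              norm_NS1 mu U (fun t => E t) Minv (fun B => op B) Q O ^+ 2 +
            (1 - L%:R^-1) *
              norm_NS2 mu U (fun t => E t) Minv (fun B => op B) Q O ^+ 2) +
         (1 - K%:R^-1) * norm_XS mu U Minv O ^+ 2))%R%:E)%E) /\
  norm_NS2 mu U (fun t => E t) Minv (fun B => op B) Q O
    <= norm_NS1 mu U (fun t => E t) Minv (fun B => op B) Q O.
Proof.
have N0 : (0 < 2 ^ n)%N by rewrite expn_gt0.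
split; [|split].
- move=> rho hrho d' W P Uw bw Bw.
  exact: (noisy_shadow_unbiased N0 hU hUmeas hMinvl hMinvr hE hEmeas hE'l hE'r hE' hQmeas
    hQ hgamma hO hrho).
- move=> rho hrho M K L hM hK hL d' W P Uw bw Bw.
  exact: (noisy_shadow_variance N0 hU hUmeas hMinvl hMinvr hE hEmeas hE'l hE'r hE' hQmeas
    hQ hgamma O hrho hM hK hL).
- exact: (norm_NS2_le_NS1 N0 hU hUmeas hMinvl hMinvr hE hEmeas hE'r hQmeas hQ hgamma O).
Qed.
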